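(* There exist absolute constants $c>0$ and $t_0$ such that for all integers $t\ge t_0$ and all integers $1\le s\le t$, \[ r_{K_s}(3,t)\ \ge\ \binom{\lfloor c\, t^2/\log^2 t\rfloor}{s}. \] In particular, there is a function $\varepsilon(t)\to 0$ as $t\to\infty$ (not depending on $s$) such that for all $1\le s\le t$, \[ \binom{r(3,t)}{s}^{1-\varepsilon(t)}\ \le\ r_{K_s}(3,t)\ \le\ \binom{r(3,t)}{s}, \] i.e. $r_{K_s}(3,t)=\binom{r(3,t)}{s}^{1-o(1)}$.
   Context: A graph $G$ is $(t_1,t_2)$-Ramsey if every coloring of the edges of $G$ with red and blue contains either a red copy of $K_{t_1}$ or a blue copy of $K_{t_2}$. The Ramsey number $r(t_1,t_2)$ is the smallest $n$ such that $K_n$ is $(t_1,t_2)$-Ramsey. For a graph $F$, the $F$-Ramsey number $r_F(t_1,t_2)$ is the minimum, over all $(t_1,t_2)$-Ramsey graphs $G$, of the number of (not necessarily induced) copies of $F$ in $G$. Thus $r_{K_s}(t_1,t_2)$ is the minimum number of $s$-cliques in a $(t_1,t_2)$-Ramsey graph. *)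

(* Defs.v *)
From mathcomp Require Import boolp classical_sets.
From mathcomp Require Import all_boot.

Set Implicit Arguments.
Unset Strict Implicit.
Unset Printing Implicit Defensive.

Record sgraph := SGraph {
  vertex :> finType;
  adj : rel vertex;
  adj_sym : symmetric adj;
  adj_irrefl : irreflexive adj }.

Definition edges (G : sgraph) : {set {set G}} :=
  [set [set p.1; p.2] | p : G * G & adj p.1 p.2].

Section Complete.
Variable n : nat.
Definition complete_adj : rel 'I_n := fun x y => x != y.
Lemma complete_adj_sym : symmetric complete_adj.
Proof. by move=> x y; rewrite /complete_adj eq_sym. Qed.
Lemma complete_adj_irrefl : irreflexive complete_adj.
Proof. by move=> x; rewrite /complete_adj eqxx. Qed.
Definition complete : sgraph := SGraph complete_adj_sym complete_adj_irrefl.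
End Complete.

Definition embedding (F G : sgraph) (f : {ffun F -> G}) : bool :=
  injectiveb f && [forall x, forall y, adj x y ==> adj (f x) (f y)].

Definition embedding_image (F G : sgraph) (f : {ffun F -> G}) :
    {set G} * {set {set G}} :=
  (f @: [set: F], [set f @: (e : {set F}) | e in edges F]).

(* A copy of F is a (not necessarily induced) subgraph of G isomorphic to F,
   given by its vertex set and its edge set; embeddings that differ by an
   automorphism of F yield the same copy. *)
Definition copies (F G : sgraph) : {set {set G} * {set {set G}}} :=
  [set embedding_image f | f in @embedding F G].

(* An edge coloring of G is given by a map on all vertex sets, of which only
   the values on edges G are used: true is red, false is blue. *)
Definition has_mono_copy (F G : sgraph) (chi : {set G} -> bool) (c : bool) :=
  exists2 H, H \in copies F G & forall e, e \in H.2 -> chi e = c.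

Definition ramsey (t1 t2 : nat) (G : sgraph) : Prop :=
  forall chi : {set G} -> bool,
    has_mono_copy (complete t1) chi true \/
    has_mono_copy (complete t2) chi false.

(* The least element of A. The default value 0 when A is empty is never reached
   in the two definitions below, by ramsey_complete_exists. *)
Definition least (A : nat -> Prop) : nat :=
  xget 0 (fun n => A n /\ forall m, A m -> n <= m).

Definition ramsey_number (t1 t2 : nat) : nat :=
  least (fun n => ramsey t1 t2 (complete n)).

Definition F_ramsey_number (F : sgraph) (t1 t2 : nat) : nat :=
  least (fun n => exists2 G, ramsey t1 t2 G & #|copies F G| = n).

Lemma leastP (A : nat -> Prop) :
  (exists n, A n) -> A (least A) /\ forall m, A m -> least A <= m.
Proof.
move=> exA; apply: (@xgetPex _ 0 (fun n => A n /\ forall m, A m -> n <= m)).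
have exb : exists n, `[< A n >] by case: exA => n An; exists n; apply/asboolP.
case: (ex_minnP exb) => n /asboolP An nmin; exists n; split=> // m Am.
exact/nmin/asboolP.
Qed.

Lemma complete_edgesP n (e : {set complete n}) :
  reflect (exists x y : complete n, x != y /\ e = [set x; y]) (e \in edges (complete n)).
Proof.
apply: (iffP imsetP) => [[[x y]]|[x [y [nxy ->]]]].
  by rewrite inE /= => nxy ->; exists x, y.
by exists (x, y); rewrite ?inE.
Qed.

Lemma clique_copy t (G : sgraph) (S : {set G}) :
    #|S| = t -> {in S &, forall x y, x != y -> adj x y} ->
  (S, [set e in edges G | e \subset S]) \in copies (complete t) G.
Proof.
move=> <- cl; pose f : {ffun complete #|S| -> G} := [ffun i => enum_val i].
have inj_f : injective f by move=> i j; rewrite !ffunE => /enum_val_inj.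
have Sf i : f i \in S by rewrite ffunE enum_valP.
apply/imsetP; exists f.
  rewrite unfold_in; apply/andP; split; first exact/injectiveP.
  apply/forallP => x; apply/forallP => y; apply/implyP => nxy.
  by apply: cl => //; rewrite (inj_eq inj_f).
have fS x : x \in S -> exists i, x = f i.
  by move=> Sx; exists (enum_rank_in Sx x); rewrite ffunE enum_rankK_in.
congr pair; apply/setP => z.
  apply/idP/imsetP => [/fS[i ->]|[i _ ->]]; last exact: Sf.
  by exists i; rewrite ?inE.
rewrite !inE; apply/andP/imsetP.
  move=> [/imsetP[[x y]]]; rewrite inE /= => xy ->.
  rewrite subUset !sub1set => /andP[/fS[i xi] /fS[j yj]].
  exists [set i; j]; last by rewrite imsetU !imset_set1 xi yj.
  apply/complete_edgesP; exists i, j; split=> //.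
  by apply: contraTneq xy => ij; rewrite xi yj ij adj_irrefl.
move=> [e /complete_edgesP[i [j [nij ->]]] ->].
rewrite imsetU !imset_set1 subUset !sub1set !Sf; split=> //.
apply/imsetP; exists (f i, f j) => //.
by rewrite inE /=; apply: cl => //; rewrite (inj_eq inj_f).
Qed.

Lemma ramsey_complete_exists t1 t2 : exists n, ramsey t1 t2 (complete n).
Proof.
pose mono (V : finType) (chi : {set V} -> bool) c (S : {set V}) :=
  {in S &, forall x y, x != y -> chi [set x; y] = c}.
have [n nP] : exists n, forall (V : finType) (chi : {set V} -> bool)
    (A : {set V}), n <= #|A| -> exists2 S : {set V}, S \subset A &
    #|S| = t1 /\ mono V chi true S \/ #|S| = t2 /\ mono V chi false S.
  have mono0 V chi c : mono V chi c set0.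
    by move=> x y; rewrite inE.
  have ext V chi c v (S : {set V}) : mono V chi c S ->
      {in S, forall x, chi [set v; x] = c} -> mono V chi c (v |: S).
    move=> mS vS x y /setU1P[->|Sx] /setU1P[->|Sy] nxy.
    - by rewrite eqxx in nxy.
    - exact: vS.
    - by rewrite setUC vS.
    - exact: mS.
  elim: t1 t2 => [|a IHa] b.
    exists 0 => V chi A _; exists set0; first exact: sub0set.
    by left; rewrite cards0.
  elim: b => [|b [n2 IH2]].
    exists 0 => V chi A _; exists set0; first exact: sub0set.
    by right; rewrite cards0.
  have [n1 IH1] := IHa b.+1.
  exists (n1 + n2).+1 => V chi A leA.
  have /card_gt0P[v Av] : 0 < #|A| by apply: leq_trans leA.
  pose N c := [set x in A :\ v | chi [set v; x] == c].
  have cN : #|N true| + #|N false| = #|A :\ v|.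
    rewrite -(cardsID (N true) (A :\ v)); congr (_ + _); apply: eq_card => x.
      by rewrite !inE; case: (x == v); case: (x \in A).
    by rewrite !inE; case: (x == v); case: (x \in A); case: (chi _).
  have NA c (S : {set V}) : S \subset N c ->
      [/\ v |: S \subset A, S \subset A, v \notin S &
          {in S, forall x, chi [set v; x] = c}].
    move=> /subsetP SN.
    have SA : S \subset A.
      by apply/subsetP => x /SN; rewrite !inE => /andP[/andP[]].
    split=> //; first by rewrite subUset sub1set Av.
      by apply/negP => /SN; rewrite !inE eqxx.
    by move=> x /SN; rewrite inE => /andP[_ /eqP].
  have := leA; rewrite (cardsD1 v) Av -cN add1n ltnS => le12.
  have [le1|lt1] := leqP n1 #|N true|.
    have [S /NA[vSA SA vS chiS] [[cS mS]|bS]] := IH1 V chi _ le1.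
      by exists (v |: S) => //; left; rewrite cardsU1 vS cS; split=> //; apply: ext.
    by exists S => //; right.
  have le2 : n2 <= #|N false|.
    by rewrite -(leq_add2l n1); apply: leq_trans le12 _; rewrite leq_add2r ltnW.
  have [S /NA[vSA SA vS chiS] [rS|[cS mS]]] := IH2 V chi _ le2.
    by exists S => //; left.
  by exists (v |: S) => //; right; rewrite cardsU1 vS cS; split=> //; apply: ext.
exists n => chi.
have [|S _ HS] := nP (complete n) chi setT; first by rewrite cardsT card_ord.
have conv t c : #|S| = t -> mono _ chi c S -> has_mono_copy (complete t) chi c.
  move=> cS mS; exists (S, [set e in edges (complete n) | e \subset S]).
    by apply: clique_copy.
  move=> e; rewrite inE => /andP[/complete_edgesP[x [y [nxy ->]]]].
  by rewrite subUset !sub1set => /andP[Sx Sy]; apply: mS.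
by case: HS => -[cS mS]; [left|right]; apply: conv.
Qed.

(* Main.v *)
Require Import Defs.
From mathcomp Require Import all_classical all_reals all_analysis.
From mathcomp Require Import all_boot all_order all_algebra all_field.
From mathcomp Require Import ring lra zify.
Import Order.TTheory GRing.Theory Num.Theory.
Import numFieldNormedType.Exports.

(* A graph with fewer than [N ^ s] ordered s-cliques has fewer than [N ^ t]
   ordered t-cliques for [t >= s], so it is enough to color a graph [G] with few
   t-cliques.  Take the points of the affine space [F ^ 3], where [#|F| = q] is
   about [t / log ^ 2 t], and the lines in the directions [(1, a, a ^ 2)].  Any
   three directions are independent, so three pairwise collinear points lie on
   one line; splitting every line into two classes, and joining points of the
   same line in different classes, gives a triangle-free graph [H].  Map the
   vertices of [G] to points at random and color an edge red when its image is
   an edge of [H]: there is no red triangle, and a t-clique is blue only if its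
   image is independent in [H].

   For random splittings, appending a point [u] to a sequence [s] of points
   keeps it independent with probability [2 ^- r], where [r] is the number of
   lines through [u] that meet [s].  Let [W] be the sum of these weights over
   all points.  The incidence structure is pseudorandom: line sums have variance
   as small as for an optimal spectral gap.  Hence, up to points of total weight
   [O(q ^ 2)], every [u] decreases [W] by a factor [1 - 1 / (16 q)], which can
   happen only [O(q log q)] times before [W = O(q ^ 2)].  So a fraction of at most
   [(O(1) / q) ^ t] of all t-tuples of points is independent on average. *)

Set Implicit Arguments.
Unset Strict Implicit.
Unset Printing Implicit Defensive.

(** * Counting cliques *)

Section Cliques.
Variable G : sgraph.
Implicit Types (S A B : {set G}) (v : G) (s : nat).

Definition is_clique S := [forall x in S, forall y in S, (x != y) ==> adj x y].

Definition nbhd v : {set G} := [set x | adj v x].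

Definition cliques s A : {set {set G}} :=
  [set S : {set G} | [&& S \subset A, #|S| == s & is_clique S]].

Definition clique_edges S : {set G} * {set {set G}} :=
  (S, [set e in edges G | e \subset S]).

Lemma is_cliqueP S :
  reflect {in S &, forall x y, x != y -> adj x y} (is_clique S).
Proof.
apply: (iffP forall_inP) => [H x y Sx Sy|H x Sx].
  by move/forall_inP: (H x Sx) => /(_ y Sy) /implyP.
by apply/forall_inP => y Sy; apply/implyP; apply: H.
Qed.

Lemma copies_cliques s : copies (complete s) G = clique_edges @: cliques s setT.
Proof.
apply/setP => H; apply/imsetP/imsetP => [[f]|[S]]; last first.
  rewrite inE => /and3P[_ /eqP cS /is_cliqueP clS] ->.
  exact/imsetP/clique_copy.
rewrite unfold_in => /andP[/injectiveP inj_f /forallP adj_f] ->.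
have fadj x y : x != y -> adj (f x) (f y).
  by move=> nxy; move/forallP: (adj_f x) => /(_ y) /implyP; apply.
exists (f @: [set: complete s]).
  rewrite inE subsetT /= card_imset // cardsT card_ord eqxx /=.
  apply/is_cliqueP => _ _ /imsetP[x _ ->] /imsetP[y _ ->] nxy.
  by apply: fadj; apply: contraNneq nxy => ->.
congr pair; apply/setP => e; rewrite inE; apply/imsetP/andP.
  move=> [_ /complete_edgesP[x [y [nxy ->]]] ->]; split; last exact: imsetS.
  rewrite imsetU !imset_set1; apply/imsetP; exists (f x, f y) => //.
  by rewrite inE /=; apply: fadj.
move=> [/imsetP[[x y]]]; rewrite inE /= => xy ->.
rewrite subUset !sub1set => /andP[/imsetP[i _ xi] /imsetP[j _ yj]].
exists [set i; j]; last by rewrite imsetU !imset_set1 xi yj.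
apply/complete_edgesP; exists i, j; split=> //.
by apply: contraTneq xy => ij; rewrite xi yj ij adj_irrefl.
Qed.

Lemma card_copies s : #|copies (complete s) G| = #|cliques s setT|.
Proof. by rewrite copies_cliques card_imset // => S S' []. Qed.

Lemma has_mono_cliqueP s (chi : {set G} -> bool) c :
  has_mono_copy (complete s) chi c <->
  exists2 S, S \in cliques s setT &
    {in S &, forall x y, x != y -> chi [set x; y] = c}.
Proof.
split=> [[H]|[S clS chiS]].
  rewrite copies_cliques => /imsetP[S clS ->] /= chiS; exists S => // x y Sx Sy nxy.
  apply: chiS; rewrite inE subUset !sub1set Sx Sy !andbT.
  apply/imsetP; exists (x, y) => //; rewrite inE /=.
  by move: clS; rewrite inE => /and3P[_ _ /is_cliqueP]; apply.
exists (clique_edges S); first by rewrite copies_cliques imset_f.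
move=> e; rewrite inE => /andP[/imsetP[[x y]]]; rewrite inE /= => xy ->.
rewrite subUset !sub1set => /andP[Sx Sy]; apply: chiS => //.
by apply: contraTneq xy => ->; rewrite adj_irrefl.
Qed.

Lemma cliques_setU1 s A v S : v \in A -> S \in cliques s (A :&: nbhd v) ->
  v \notin S /\ v |: S \in cliques s.+1 A.
Proof.
move=> Av; rewrite inE subsetI => /and3P[/andP[SA /subsetP Sv] /eqP cS /is_cliqueP clS].
have vS : v \notin S by apply/negP => /Sv; rewrite inE adj_irrefl.
split=> //; rewrite inE subUset sub1set Av SA cardsU1 vS cS eqxx /=.
apply/is_cliqueP => x y /setU1P[->|Sx] /setU1P[->|Sy] nxy.
- by rewrite eqxx in nxy.
- by move/Sv: Sy; rewrite inE.
- by move/Sv: Sx; rewrite inE adj_sym.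
- exact: clS.
Qed.

Lemma cliques_setD1 s A v S : v \in S -> S \in cliques s.+1 A ->
  v \in A /\ S :\ v \in cliques s (A :&: nbhd v).
Proof.
move=> Sv; rewrite inE => /and3P[/subsetP SA /eqP cS /is_cliqueP clS].
split; first exact: SA.
rewrite inE; apply/and3P; split.
- apply/subsetP => x /setD1P[xv Sx]; rewrite !inE SA //=.
  by apply: clS => //; rewrite eq_sym.
- by move: cS; rewrite (cardsD1 v) Sv add1n => -[->].
- by apply/is_cliqueP => x y /setD1P[_ Sx] /setD1P[_ Sy]; apply: clS.
Qed.

(** Double counting of pairs of an [s.+1]-clique and a vertex [v] in it: removing [v] leaves an
    [s]-clique in the link of [v]. *)
Lemma card_cliquesS s A :
  s.+1 * #|cliques s.+1 A| = \sum_(v in A) #|cliques s (A :&: nbhd v)|.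
Proof.
transitivity (\sum_(S in cliques s.+1 A) \sum_(v in S) 1).
  rewrite mulnC -sum_nat_const; apply: eq_bigr => S; rewrite inE.
  by case/and3P=> _ /eqP cS _; rewrite sum1_card.
rewrite (exchange_big_dep (mem A)) /=; last first.
  by move=> S v SC vS; case: (cliques_setD1 vS SC).
apply: eq_bigr => v Av; rewrite sum1dep_card.
rewrite -[RHS](card_in_imset (f := fun S => v |: S)) => [|S S' SC SC' eqS].
  congr #|pred_of_set _|; apply/setP => S; rewrite in_set.
  apply/andP/imsetP => [[SC Sv]|[S' SC ->]].
    by exists (S :\ v); [case: (cliques_setD1 Sv SC)|rewrite setD1K].
  by case: (cliques_setU1 Av SC) => _ ->; rewrite setU11.
case: (cliques_setU1 Av SC) (cliques_setU1 Av SC') => vS _ [vS' _].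
by rewrite -(setU1K vS) eqS setU1K.
Qed.

Lemma cliquesS s A B : A \subset B -> #|cliques s A| <= #|cliques s B|.
Proof.
move=> AB; apply: subset_leq_card; apply/subsetP => S; rewrite !inE.
by case/andP => SA ->; rewrite (subset_trans SA AB).
Qed.

Lemma card_cliques0 A : #|cliques 0 A| = 1.
Proof.
rewrite (_ : cliques 0 A = [set set0]) ?cards1 //.
apply/setP => S; rewrite !inE cards_eq0.
apply/and3P/eqP => [[_ /eqP]//|->]; rewrite sub0set eqxx; split=> //.
by apply/is_cliqueP => x; rewrite inE.
Qed.

(* [s`! * #|cliques s A|] counts the ordered s-cliques in A. *)
Definition ordered_cliques s A := s`! * #|cliques s A|.

Lemma ordered_cliquesS s A :
  ordered_cliques s.+1 A = \sum_(v in A) ordered_cliques s (A :&: nbhd v).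
Proof.
by rewrite /ordered_cliques factS (mulnC s.+1) -mulnA card_cliquesS big_distrr.
Qed.

End Cliques.

(** * Inequalities for powers, falling factorials and binomial coefficients *)

Section PowerBounds.

Lemma leq_expn2r m n e : m <= n -> m ^ e <= n ^ e.
Proof. by case: e => // e; rewrite leq_exp2r. Qed.

(** With real [s]-th roots one would just add two inequalities. Over the naturals, both sides are
    expanded binomially and compared termwise after raising each term to the power [s]. *)
Lemma leq_expn_add s X a a' b b' :
  0 < s -> a ^ s <= X * b ^ s -> a' ^ s <= X * b' ^ s ->
  (a + a') ^ s <= X * (b + b') ^ s.
Proof.
move=> s_gt0 le_a le_a'; rewrite !expnDn big_distrr /=.
apply: leq_sum => i _; rewrite [leqRHS]mulnCA leq_mul2l; apply/orP; right.
have le_i : i <= s by rewrite -ltnS.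
rewrite -(leq_exp2r _ _ s_gt0) !expnMn -!expnM.
rewrite (mulnC _ s) (mulnC i s) !expnM.
apply: leq_trans (leq_mul (leq_expn2r (s - i) le_a) (leq_expn2r i le_a')) _.
by rewrite !expnMn mulnACA -expnD subnK.
Qed.

Lemma leq_expn_sum (I : finType) (P : pred I) s X (a b : I -> nat) : 0 < s ->
  (forall i, P i -> a i ^ s <= X * b i ^ s) ->
  (\sum_(i | P i) a i) ^ s <= X * (\sum_(i | P i) b i) ^ s.
Proof.
move=> s_gt0 le_ab; elim/big_rec2: _ => [|i B A Pi le_AB].
  by rewrite exp0n.
by apply: leq_expn_add => //; apply: le_ab.
Qed.

Lemma leq_subn_ffact m n : (m - n) ^ n <= m ^_ n.
Proof.
rewrite ffact_prod -{2}(card_ord n) -prod_nat_const; apply: leq_prod => i _.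
by rewrite leq_sub2l // ltnW.
Qed.

Lemma leq_ffact_expn m n : m ^_ n <= m ^ n.
Proof.
have -> : m ^ n = \prod_(i < n) m by rewrite prod_nat_const card_ord.
rewrite ffact_prod; apply: leq_prod => i _.
exact: leq_subr.
Qed.

Lemma bin_le_expn2 m n : 'C(m, n) <= 2 ^ m.
Proof.
have -> : 2 ^ m = #|powerset [set: 'I_m]| by rewrite card_powerset cardsT card_ord.
rewrite -{1}(card_ord m) -card_draws.
by apply: subset_leq_card; apply/subsetP => A _; rewrite powersetE subsetT.
Qed.

(** The falling factorial [(2 * t) ^_ t] is at least [t ^ t], and it is the factorial of [t] times
    ['C(2 * t, t)], which is at most [2 ^ (2 * t)]. *)
Lemma expnn_le_fact t : t ^ t <= 4 ^ t * t`!.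
Proof.
have := leq_subn_ffact (2 * t) t; rewrite {1}mul2n -addnn addnK => le_t.
apply: leq_trans le_t _; rewrite -bin_ffact leq_mul2r; apply/orP; right.
by rewrite -[4]/(2 ^ 2) -expnM bin_le_expn2.
Qed.

End PowerBounds.

Section OrderedCliques.
Variable G : sgraph.
Implicit Types (A : {set G}) (s t : nat).

(* Induction through the links: with [a v = ordered_cliques s (A :&: nbhd v)] and
   [b v = ordered_cliques s.-1 (A :&: nbhd v)] the induction hypothesis gives
   [a v ^ s <= ordered_cliques s A * b v ^ s]. *)
Lemma ordered_cliques_expS s A :
  ordered_cliques s.+1 A ^ s <= ordered_cliques s A ^ s.+1.
Proof.
elim: s A => [|s IHs] A.
  by rewrite expn0 expn1 /ordered_cliques card_cliques0.
rewrite [in X in X ^ _ <= _]ordered_cliquesS [leqRHS]expnS [in X in _ <= _ * X]ordered_cliquesS.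
apply: leq_expn_sum => // v _; rewrite expnS leq_mul //.
by rewrite /ordered_cliques leq_mul2l cliquesS ?subsetIl ?orbT.
Qed.

Lemma ordered_cliques_exp s t A : s <= t ->
  ordered_cliques t A ^ s <= ordered_cliques s A ^ t.
Proof.
elim: t => [|t IHt]; first by rewrite leqn0 => /eqP->.
rewrite leq_eqVlt => /predU1P[->//|]; rewrite ltnS => st.
have [t0|t_gt0] := posnP t.
  by move: st; rewrite t0 leqn0 => /eqP->; rewrite /ordered_cliques card_cliques0.
rewrite -(leq_exp2r _ _ t_gt0) -!expnM mulnC (mulnC t.+1) !expnM.
apply: leq_trans (leq_expn2r s (ordered_cliques_expS t A)) _.
by rewrite -expnM mulnC expnM leq_expn2r // IHt.
Qed.

End OrderedCliques.

(** * The quadratic upper bound on [r(3, t)] and elementary facts on Ramsey graphs *)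

Lemma is_clique_complete n (S : {set complete n}) : is_clique S.
Proof. exact/is_cliqueP. Qed.

Lemma card_copies_complete s n : #|copies (complete s) (complete n)| = 'C(n, s).
Proof.
have := card_draws 'I_n s; rewrite card_ord card_copies => <-; apply: eq_card => S.
by rewrite !inE subsetT is_clique_complete andbT.
Qed.

(** If a vertex has [t] red neighbours, these span a red edge, closing a red triangle, or form a
    blue clique. Otherwise vertices are picked greedily, each excluding at most [t] vertices: itself
    and its red neighbours. *)
Lemma ramsey3_complete t n : t ^ 2 <= n -> ramsey 3 t (complete n).
Proof.
move=> n_ge chi; pose G := complete n.
have cliqueT s (S : {set G}) : #|S| = s -> S \in cliques s setT.
  by move=> cS; rewrite inE subsetT cS eqxx is_clique_complete.
pose N (x : G) := [set y | (y != x) && chi [set x; y]].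
have [/existsP[x Nx]|small] := boolP [exists x, t <= #|N x|].
  have [/exists_inP[y yN /exists_inP[z zN /andP[yz chi_yz]]]|blueN] :=
      boolP [exists y in N x, exists z in N x, (y != z) && chi [set y; z]].
    move: yN zN; rewrite !inE => /andP[yx chi_xy] /andP[zx chi_xz].
    left; apply/(@has_mono_cliqueP G); exists [set x; y; z].
      apply: cliqueT; rewrite -setUA cardsU1 cards2 yz !inE negb_or.
      by rewrite !(eq_sym x) yx zx.
    move=> u v; rewrite !inE => /orP[/orP[]|]/eqP-> /orP[/orP[]|]/eqP-> //;
      by rewrite ?eqxx // setUC.
  have [S SN cS] : exists2 S : {set G}, S \subset N x & #|S| = t.
    have /card_geqP[r [uniq_r size_r rN]] := Nx; exists [set y in r].
      by apply/subsetP => y; rewrite inE => /rN.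
    by rewrite cardsE (card_uniqP uniq_r).
  right; apply/(@has_mono_cliqueP G); exists S; first exact: cliqueT.
  move=> y z Sy Sz yz; apply/negbTE; apply: contra blueN => chi_yz.
  apply/exists_inP; exists y; first exact: (subsetP SN).
  by apply/exists_inP; exists z; rewrite ?yz //; apply: (subsetP SN).
have [t0|t_gt0] := posnP t.
  right; apply/(@has_mono_cliqueP G); exists set0; last by move=> x y; rewrite inE.
  by apply: cliqueT; rewrite cards0.
have {}small x : #|N x| < t.
  by rewrite ltnNge; apply: contra small => Nx; apply/existsP; exists x.
have [S [_ cS chiS]] : exists S : {set G}, [/\ S \subset [set: G], #|S| = t &
    {in S &, forall x y, x != y -> chi [set x; y] = false}].
  have: t * t <= #|[set: G]| by rewrite cardsT card_ord mulnn.
  move: {1 3}t [set: G] => k A.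
  elim: k A => [|k IHk] A kA.
    by exists set0; split; rewrite ?sub0set ?cards0 // => x y; rewrite inE.
  have /card_gt0P[x Ax] : 0 < #|A| by apply: leq_trans kA; rewrite mulSn ltn_addr.
  have [|S [SA cS chiS]] := IHk (A :\: (x |: N x)).
    rewrite cardsD leq_subRL; last by rewrite subset_leq_card ?subsetIl.
    apply: leq_trans kA; rewrite mulSn leq_add2r.
    apply: leq_trans (subset_leq_card (subsetIr _ _)) _.
    by apply: leq_trans (leq_card_setU _ _) _; rewrite cards1.
  have xS y : y \in S -> [/\ y \in A, y != x & chi [set x; y] = false].
    move/(subsetP SA); rewrite !inE negb_or => /andP[/andP[-> /=]].
    by move=> /negPf-> ->.
  exists (x |: S); split.
  - by rewrite subUset sub1set Ax; apply/subsetP => y /xS[].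
  - by rewrite cardsU1 cS; case: (boolP (x \in S)) => // /xS[_]; rewrite eqxx.
  - move=> y z /setU1P[->|Sy] /setU1P[->|Sz] yz; first by rewrite eqxx in yz.
    + by case: (xS z Sz).
    + by rewrite setUC; case: (xS y Sy).
    + exact: chiS.
by right; apply/(@has_mono_cliqueP G); exists S; first exact: cliqueT.
Qed.

(** Coloring all edges blue yields a [t]-clique, and [ordered_cliques_exp] then yields an
    [s]-clique. *)
Lemma ramsey_cliques_gt0 (G : sgraph) s t : 0 < s <= t -> ramsey 3 t G ->
  0 < #|copies (complete s) G|.
Proof.
move=> /andP[s_gt0 st] /(_ xpred0)[/has_mono_cliqueP[S]|/has_mono_cliqueP[S SC _]].
  rewrite inE => /and3P[_ /eqP cS _] chiS.
  have /card_gt1P[x [y [Sx Sy xy]]] : 1 < #|S| by rewrite cS.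
  by have := chiS x y Sx Sy xy.
have t_gt0 : 0 < ordered_cliques t [set: G].
  by rewrite muln_gt0 fact_gt0; apply/card_gt0P; exists S.
have := ordered_cliques_exp [set: G] st; rewrite leqNgt card_copies lt0n.
apply: contraNneq => s0.
by rewrite /ordered_cliques s0 muln0 exp0n ?expn_gt0 ?t_gt0 // (leq_trans s_gt0).
Qed.

Section RamseyNumbers.
Variables s t : nat.

Lemma F_ramsey_numberP : exists2 G, ramsey 3 t G &
  #|copies (complete s) G| = F_ramsey_number (complete s) 3 t.
Proof.
have [|//] := @leastP
  (fun n => exists2 G, ramsey 3 t G & #|copies (complete s) G| = n).
have [n ramn] := ramsey_complete_exists 3 t.
  by exists #|copies (complete s) (complete n)|, (complete n).
Qed.

Lemma F_ramsey_number_le_bin :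
  F_ramsey_number (complete s) 3 t <= 'C(ramsey_number 3 t, s).
Proof.
have [|_ minF] := @leastP
  (fun n => exists2 G, ramsey 3 t G & #|copies (complete s) G| = n).
  have [n ramn] := ramsey_complete_exists 3 t.
  by exists #|copies (complete s) (complete n)|, (complete n).
apply: minF; exists (complete (ramsey_number 3 t)); last exact: card_copies_complete.
by have [] := leastP (ramsey_complete_exists 3 t).
Qed.

Lemma ramsey_number_le : ramsey_number 3 t <= t ^ 2.
Proof.
have [_] := leastP (ramsey_complete_exists 3 t); apply; exact: ramsey3_complete.
Qed.

End RamseyNumbers.

Local Open Scope ring_scope.

(** * Lines in the directions (1, a, a^2) *)

Section LineSums.
Variables (R : realFieldType) (F : finFieldType).
Local Notation P := (F * F * F)%type.
Implicit Types (a b c tau : F) (u v x : P) (f g w : P -> R).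

Definition dirvec a tau : P := (tau, tau * a, tau * a ^+ 2).

Lemma dirvec0 a : dirvec a 0 = 0.
Proof. by rewrite /dirvec !mul0r. Qed.

Lemma dirvecD a s t : dirvec a (s + t) = dirvec a s + dirvec a t.
Proof. by rewrite /dirvec !mulrDl. Qed.

Lemma dirvecN a s : dirvec a (- s) = - dirvec a s.
Proof. by rewrite /dirvec !mulNr. Qed.

(** A Vandermonde argument: combining the coordinates with the coefficients of [(X - b) * (X - c)]
    leaves [(a - b) * (a - c) * r = 0], and likewise for [s] and [t]. *)
Lemma dirvec_indep a b c r s t : a != b -> a != c -> b != c ->
  dirvec a r + dirvec b s + dirvec c t = 0 -> [/\ r = 0, s = 0 & t = 0].
Proof.
move=> ab ac bc [e0 e1 e2].
have kill (d1 d2 z : F) : d1 != 0 -> d2 != 0 -> d1 * d2 * z = 0 -> z = 0.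
  by move=> n1 n2 /eqP; rewrite !mulf_eq0 (negPf n1) (negPf n2) => /eqP.
have ba := ab; have ca := ac; have cb := bc.
rewrite -subr_eq0 in ab; rewrite -subr_eq0 in ac; rewrite -subr_eq0 in bc.
rewrite eq_sym -subr_eq0 in ba; rewrite eq_sym -subr_eq0 in ca.
rewrite eq_sym -subr_eq0 in cb.
split.
- apply: (kill _ _ _ ab ac).
  transitivity ((r * a ^+ 2 + s * b ^+ 2 + t * c ^+ 2)
    - (b + c) * (r * a + s * b + t * c) + b * c * (r + s + t)); first by ring.
  by rewrite e0 e1 e2 !mulr0 subrr add0r.
- apply: (kill _ _ _ ba bc).
  transitivity ((r * a ^+ 2 + s * b ^+ 2 + t * c ^+ 2)
    - (a + c) * (r * a + s * b + t * c) + a * c * (r + s + t)); first by ring.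
  by rewrite e0 e1 e2 !mulr0 subrr add0r.
- apply: (kill _ _ _ ca cb).
  transitivity ((r * a ^+ 2 + s * b ^+ 2 + t * c ^+ 2)
    - (a + b) * (r * a + s * b + t * c) + a * b * (r + s + t)); first by ring.
  by rewrite e0 e1 e2 !mulr0 subrr add0r.
Qed.

(* A function of the point [v]: the sum of [f] over a line appears at each of the
   [#|F|] points of the line. *)
Definition linesum a f v := \sum_tau f (v + dirvec a tau).

Definition dot f g := \sum_v f v * g v.

Local Notation q := (#|F|%:R : R).

Lemma eq_linesum a f g : f =1 g -> linesum a f =1 linesum a g.
Proof. by move=> fg v; apply: eq_bigr => t _. Qed.

Lemma linesum_dirvec a f v s : linesum a f (v + dirvec a s) = linesum a f v.
Proof.
rewrite /linesum [RHS](reindex_inj (addrI s)); apply: eq_bigr => t _ /=.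
by rewrite dirvecD addrA.
Qed.

Lemma linesum_idem a f v : linesum a (linesum a f) v = q * linesum a f v.
Proof.
rewrite {1}/linesum (eq_bigr (fun=> linesum a f v)) => [|t _]; last first.
  exact: linesum_dirvec.
by rewrite sumr_const mulr_natl.
Qed.

Lemma linesumC a b f v : linesum a (linesum b f) v = linesum b (linesum a f) v.
Proof.
rewrite /linesum exchange_big; apply: eq_bigr => s _; apply: eq_bigr => t _.
by rewrite addrAC.
Qed.

Lemma sum_linesum a f : \sum_v linesum a f v = q * \sum_v f v.
Proof.
rewrite /linesum exchange_big /= (eq_bigr (fun=> \sum_v f v)) => [|t _].
  by rewrite sumr_const mulr_natl.
by rewrite [RHS](reindex_inj (addIr (dirvec a t))).
Qed.

(** Three distinct directions form a basis of [F ^ 3], so summing along them in turn reaches every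
    point exactly once. *)
Lemma linesum3 a b c f v : a != b -> a != c -> b != c ->
  linesum a (linesum b (linesum c f)) v = \sum_x f x.
Proof.
move=> ab ac bc; rewrite /linesum.
transitivity (\sum_(p : P) f (v + dirvec a p.1.1 + dirvec b p.1.2 + dirvec c p.2)).
  rewrite -(pair_big xpredT xpredT
    (fun rs t => f (v + dirvec a rs.1 + dirvec b rs.2 + dirvec c t))) /=.
  by rewrite -(pair_big xpredT xpredT
    (fun r s => \sum_t f (v + dirvec a r + dirvec b s + dirvec c t))) /=.
pose h (p : P) := v + dirvec a p.1.1 + dirvec b p.1.2 + dirvec c p.2.
rewrite [RHS](reindex_inj (h := h)) // => -[[r s] t] [[r' s'] t'] /= e.
suff [] : [/\ r - r' = 0, s - s' = 0 & t - t' = 0].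
  by move=> /subr0_eq-> /subr0_eq-> /subr0_eq->.
apply: (dirvec_indep ab ac bc); rewrite !dirvecD !dirvecN.
transitivity (h (r, s, t) - h (r', s', t')); last by rewrite e subrr.
rewrite /h /= [in RHS]opprD [in RHS]opprD [in RHS]opprD.
rewrite [RHS]addrACA; congr (_ + _); rewrite [RHS]addrACA; congr (_ + _).
by rewrite [RHS]addrACA subrr add0r.
Qed.

Lemma dotC f g : dot f g = dot g f.
Proof. by apply: eq_bigr => v _; rewrite mulrC. Qed.

Lemma eq_dot f f' g g' : f =1 f' -> g =1 g' -> dot f g = dot f' g'.
Proof. by move=> ff gg; apply: eq_bigr => v _; rewrite ff gg. Qed.

Lemma dot_suml (I : finType) (p : pred I) (h : I -> P -> R) g :
  dot (fun x => \sum_(i | p i) h i x) g = \sum_(i | p i) dot (h i) g.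
Proof.
rewrite /dot exchange_big /=; apply: eq_bigr => v _; exact: mulr_suml.
Qed.

Lemma dot_sumr (I : finType) (p : pred I) (h : I -> P -> R) g :
  dot g (fun x => \sum_(i | p i) h i x) = \sum_(i | p i) dot g (h i).
Proof. by rewrite dotC dot_suml; apply: eq_bigr => i _; apply: dotC. Qed.

Lemma dot_linesum a f g : dot (linesum a f) g = dot f (linesum a g).
Proof.
rewrite /dot /linesum.
under eq_bigr do rewrite mulr_suml.
under [RHS]eq_bigr do rewrite mulr_sumr.
rewrite exchange_big [RHS]exchange_big /= [RHS](reindex_inj (@oppr_inj F)) /=.
apply: eq_bigr => t _; rewrite [RHS](reindex_inj (addIr (dirvec a t))).
by apply: eq_bigr => v _; rewrite dirvecN addrK.
Qed.

Lemma dot_linesum2 a f : dot (linesum a f) (linesum a f) = q * dot (linesum a f) f.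
Proof.
rewrite dot_linesum dotC /dot mulr_sumr; apply: eq_bigr => v _.
by rewrite linesum_idem mulrA.
Qed.

Lemma dot_zcl z f g : dot (fun x => z * f x) g = z * dot f g.
Proof. by rewrite /dot mulr_sumr; apply: eq_bigr => v _; rewrite mulrA. Qed.

Lemma dot_ge0 f : 0 <= dot f f.
Proof. by apply: sumr_ge0 => v _; rewrite -expr2 sqr_ge0. Qed.

Definition allsum f v := \sum_a linesum a f v.

Section MeanZero.
Variable f : P -> R.
Hypothesis f0 : \sum_v f v = 0.

Lemma dot_linesum3 a b c : a != b -> a != c -> b != c ->
  dot (linesum b (linesum a f)) (linesum c (linesum a f)) = 0.
Proof.
move=> ab ac bc; rewrite dot_linesum /dot big1 // => v _.
by rewrite linesum3 ?f0 ?mulr0 // eq_sym.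
Qed.

(* Bessel's inequality: by [dot_linesum3] the functions [linesum b y], [b != a],
   are pairwise orthogonal, and [linesum b] is [q] times a projection. *)
Lemma bessel_linesum a :
  \sum_(b | b != a) dot (linesum a f) (linesum b f) <=
    dot (linesum a f) (linesum a f).
Proof.
pose y := linesum a f; pose Y v := \sum_(b | b != a) linesum b y v.
have q_gt0 : 0 < q by rewrite ltr0n; apply/card_gt0P; exists a.
pose B := \sum_(b | b != a) dot (linesum b y) y.
have YY : dot Y Y = q * B.
  rewrite dot_suml /B mulr_sumr; apply: eq_bigr => b ba.
  rewrite dot_sumr (bigD1 b) //= big1 ?addr0 ?dot_linesum2 // => c /andP[ca cb].
  by rewrite dot_linesum3 // eq_sym.
have Yy : dot Y y = B by rewrite dot_suml.
(* By [YY] and [Yy], the squared norm of [q y - Y] is [q ^ 2 * dot y y - q * B]. *)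
have H : B <= q * dot y y.
  rewrite -(ler_pM2l q_gt0); have := dot_ge0 (fun v => q * y v - Y v).
  have -> : dot (fun v => q * y v - Y v) (fun v => q * y v - Y v) =
      q * (q * dot y y) - 2 * q * dot Y y + dot Y Y.
    rewrite /dot !mulr_sumr -sumrB -big_split /=; apply: eq_bigr => v _; ring.
  rewrite Yy YY; lra.
suff eB : B = q * \sum_(b | b != a) dot (linesum a f) (linesum b f).
  by move: H; rewrite eB ler_pM2l.
rewrite /B mulr_sumr; apply: eq_bigr => b _; rewrite -dot_linesum -dot_linesum.
rewrite -dot_zcl; apply: eq_dot => // v.
rewrite linesumC (eq_linesum b (linesum_idem a f)).
by rewrite /linesum mulr_sumr.
Qed.

(** The diagonal terms of [dot (allsum f) (allsum f)] add up to [q * dot (allsum f) f], and Bessel's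
    inequality bounds the other terms by the same amount. *)
Lemma dot_allsum_le : dot (allsum f) (allsum f) <= 2 * q * dot (allsum f) f.
Proof.
have -> : 2 * q * dot (allsum f) f = 2 * \sum_a dot (linesum a f) (linesum a f).
  rewrite -mulrA; congr (2 * _); rewrite dot_suml mulr_sumr.
  by apply: eq_bigr => a _; rewrite dot_linesum2.
rewrite dot_suml mulr_sumr; apply: ler_sum => a _.
by rewrite dot_sumr (bigD1 a) //= mulr2n mulrDl mul1r lerD2l bessel_linesum.
Qed.

(** The previous bound says that the eigenvalues of [allsum] on mean-zero functions are at most
    [2 q], against [q ^ 2] on constants. Spectral theory is replaced by expanding the squared norm
    of [allsum f - 2 q f]. *)
Lemma dot_allsum_self_le : dot (allsum f) f <= 2 * q * dot f f.
Proof.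
have q_gt0 : 0 < q by rewrite ltr0n; apply/card_gt0P; exists 0.
have := dot_ge0 (fun v => allsum f v - 2 * q * f v); have := dot_allsum_le.
have -> : dot (fun v => allsum f v - 2 * q * f v)
    (fun v => allsum f v - 2 * q * f v) =
    dot (allsum f) (allsum f) - 4 * q * dot (allsum f) f + 4 * q * (q * dot f f).
  rewrite /dot !mulr_sumr -sumrB -big_split /=; apply: eq_bigr => v _; ring.
by move=> H1 H2; rewrite -(ler_pM2l q_gt0); lra.
Qed.

Lemma sum_linesum_sqr_le :
  \sum_a dot (linesum a f) (linesum a f) <= 2 * q ^+ 2 * dot f f.
Proof.
have -> : \sum_a dot (linesum a f) (linesum a f) = q * dot (allsum f) f.
  by rewrite dot_suml mulr_sumr; apply: eq_bigr => a _; rewrite dot_linesum2.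
have := dot_allsum_self_le; move=> H.
have := ler_wpM2l (ler0n R #|F|) H; rewrite expr2; lra.
Qed.

Lemma dot_allsum_sqr_le : dot (allsum f) (allsum f) <= 4 * q ^+ 2 * dot f f.
Proof.
apply: le_trans dot_allsum_le _; have H := dot_allsum_self_le.
have := ler_wpM2l (ler0n R #|F|) H; rewrite expr2; lra.
Qed.

End MeanZero.
End LineSums.

(** * Second moments of the line sums of a weight function *)

Lemma sumr_card (R : pzSemiRingType) (I : finType) (A : {pred I}) (x : R) :
  \sum_(i in A) x = #|A|%:R * x.
Proof. by rewrite sumr_const mulr_natl. Qed.

Lemma sqr_sum_le (R : realFieldType) (I : finType) (A : {pred I}) (x : I -> R) :
  (\sum_(i in A) x i) ^+ 2 <= #|A|%:R * \sum_(i in A) x i ^+ 2.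
Proof.
set X := \sum_(i in A) x i; set Y := \sum_(i in A) x i ^+ 2.
have [A0|A_gt0] := posnP #|A|.
  rewrite A0 mul0r /X big_pred0 ?expr0n // => i.
  by have /card0_eq/(_ i) := A0.
rewrite -(ler_pM2l (x := #|A|%:R)) ?ltr0n //.
have : 0 <= \sum_(i in A) (#|A|%:R * x i - X) ^+ 2.
  by apply: sumr_ge0 => i _; apply: sqr_ge0.
suff -> : \sum_(i in A) (#|A|%:R * x i - X) ^+ 2 =
    #|A|%:R * (#|A|%:R * Y) - #|A|%:R * X ^+ 2 by rewrite subr_ge0.
have -> z : \sum_(i in A) (#|A|%:R * x i - z) ^+ 2 =
    #|A|%:R ^+ 2 * Y - 2 * #|A|%:R * z * X + \sum_(i in A) z ^+ 2.
  by rewrite !mulr_sumr -sumrB -big_split /=; apply: eq_bigr => i _; ring.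
by rewrite sumr_card; ring.
Qed.

Section Weights.
Variables (R : realFieldType) (F : finFieldType).
Local Notation P := (F * F * F)%type.
Local Notation q := (#|F|%:R : R).
Implicit Types (a t : F) (u v x : P) (s : seq P).

Lemma q_gt0 : 0 < q.
Proof. by rewrite ltr0n; apply/card_gt0P; exists 0. Qed.

Lemma card_point : #|{: P}|%:R = q ^+ 3 :> R.
Proof. by rewrite !card_prod !natrM; ring. Qed.

Section Discrepancy.
Variable w : P -> R.
Hypothesis w01 : forall v, 0 <= w v <= 1.
Let W := \sum_v w v.
Let f v := w v - W / q ^+ 3.

Let W_ge0 : 0 <= W.
Proof. by apply: sumr_ge0 => v _; case/andP: (w01 v). Qed.

Let sum_f : \sum_v f v = 0.
Proof.
rewrite sumrB sumr_card card_point mulrCA divff ?mulr1 ?subrr //.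
by rewrite expf_neq0 // gt_eqF ?q_gt0.
Qed.

Let dot_f : dot f f <= W.
Proof.
have -> : dot f f = \sum_v (w v * w v - 2 * (W / q ^+ 3) * w v + (W / q ^+ 3) ^+ 2).
  by apply: eq_bigr => v _; rewrite /f; ring.
rewrite big_split sumrB /= -mulr_sumr -/W sumr_card card_point.
have -> : \sum_v w v * w v - 2 * (W / q ^+ 3) * W + q ^+ 3 * (W / q ^+ 3) ^+ 2
    = \sum_v w v * w v - W ^+ 2 / q ^+ 3.
  by field; rewrite gt_eqF ?q_gt0.
rewrite lerBlDr ler_wpDr ?divr_ge0 ?sqr_ge0 ?exprn_ge0 ?ler0n //.
by apply: ler_sum => v _; have /andP[w0 w1] := w01 v; rewrite ler_piMr.
Qed.

Let linesum_w a v : linesum a w v = linesum a f v + W / q ^+ 2.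
Proof.
rewrite /linesum /f sumrB sumr_card; field.
by rewrite gt_eqF ?q_gt0.
Qed.

(** A line sum of [w] is the mean [W / q ^ 2] plus the line sum of the mean-zero part [f]. The means
    contribute [W ^ 2]; the rest is bounded by [sum_linesum_sqr_le] and [dot f f <= W]. *)
Lemma sum_linesum_weight_le :
  \sum_v \sum_a linesum a w v ^+ 2 <= 2 * q ^+ 2 * W + W ^+ 2.
Proof.
rewrite exchange_big /=.
have -> : \sum_a \sum_v linesum a w v ^+ 2 =
    \sum_a (dot (linesum a f) (linesum a f) + W ^+ 2 / q).
  apply: eq_bigr => a _.
  have -> : \sum_v linesum a w v ^+ 2 = \sum_v (linesum a f v * linesum a f v
      + 2 * (W / q ^+ 2) * linesum a f v + (W / q ^+ 2) ^+ 2).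
    by apply: eq_bigr => v _; rewrite linesum_w; ring.
  rewrite 2!big_split /= -mulr_sumr sum_linesum sum_f !mulr0 addr0.
  rewrite sumr_card card_point; congr (_ + _).
  by field; rewrite gt_eqF ?q_gt0.
rewrite big_split sumr_card /= mulrCA divff ?gt_eqF ?q_gt0 // mulr1.
rewrite lerD2r; apply: le_trans (sum_linesum_sqr_le sum_f) _.
by rewrite ler_wpM2l // mulr_ge0 ?ler0n ?exprn_ge0.
Qed.

(** Chebyshev's inequality: [allsum w] has mean [W / q] and squared deviations of sum at most
    [4 q ^ 2 W], and every counted point deviates by at least [W / (2 q)]. *)
Lemma card_allsum_small_le :
  #|[pred v | allsum w v < W / (2 * q)]|%:R * W <= 16 * q ^+ 4.
Proof.
have [->|W_neq0] := eqVneq W 0; first by rewrite mulr0 mulr_ge0 ?exprn_ge0.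
have W_gt0 : 0 < W by rewrite lt_def W_neq0.
have q0 := q_gt0.
pose A := [pred v | allsum w v < W / (2 * q)].
have H : \sum_(v in A) (W / (2 * q)) ^+ 2 <= 4 * q ^+ 2 * W.
  apply: (@le_trans _ _ (dot (allsum f) (allsum f))).
    rewrite /dot [leRHS](bigID [in A]) /= ler_wpDr //.
      by apply: sumr_ge0 => v _; rewrite -expr2 sqr_ge0.
    apply: ler_sum => v; rewrite inE => Av.
    have e : allsum w v = allsum f v + W / q.
      rewrite /allsum (eq_bigr _ (fun a _ => linesum_w a v)) big_split /=.
      by rewrite sumr_card; congr (_ + _); field; rewrite gt_eqF.
    have lt : W / (2 * q) <= - allsum f v.
      have h : W / q = 2 * (W / (2 * q)) by field; rewrite gt_eqF.
      by move: Av; rewrite e h; lra.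
    rewrite -expr2 -(sqrrN (allsum f v)) ler_sqr ?nnegrE //.
      by rewrite divr_ge0 ?mulr_ge0 ?ltW.
    by apply: le_trans lt; rewrite divr_ge0 ?mulr_ge0 ?ltW.
  apply: le_trans (dot_allsum_sqr_le sum_f) _.
  by rewrite ler_wpM2l // mulr_ge0 ?ler0n ?exprn_ge0.
move: H; rewrite sumr_card.
have -> : #|A|%:R * (W / (2 * q)) ^+ 2 = #|A|%:R * W * (W / (4 * q ^+ 2)).
  by field; rewrite gt_eqF.
have -> : 4 * q ^+ 2 * W = 16 * q ^+ 4 * (W / (4 * q ^+ 2)).
  by field; rewrite gt_eqF.
by rewrite ler_pM2r // divr_gt0 ?mulr_gt0 ?exprn_gt0.
Qed.

End Discrepancy.

(** * Weights of points relative to a sequence *)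

(* The directions [a] such that the line through [v] in direction [a] meets [s]. *)
Definition cov s v : {set F} :=
  [set a | has (fun x => [exists t, x == v + dirvec a t]) s].

Definition wt s v : R := 2^-1 ^+ #|cov s v|.

Definition total_wt s : R := \sum_v wt s v.

Lemma wt_gt0 s v : 0 < wt s v.
Proof. by rewrite exprn_gt0 ?invr_gt0. Qed.

Lemma wt01 s v : 0 <= wt s v <= 1.
Proof. by rewrite ltW ?wt_gt0 //= exprn_ile1 ?invr_ge0 ?invf_le1 ?ler1n. Qed.

Lemma cov_cons u s v : cov s v \subset cov (u :: s) v.
Proof. by apply/subsetP => a; rewrite !inE /= => ->; rewrite orbT. Qed.

Lemma cov_dirvec s v a t : (a \in cov s (v + dirvec a t)) = (a \in cov s v).
Proof.
rewrite !inE; apply: eq_has => x; apply/existsP/existsP => -[r /eqP->].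
  by exists (t + r); rewrite dirvecD addrA.
by exists (r - t); rewrite addrAC dirvecD dirvecN addrA subrK.
Qed.

Lemma wt_cons_le u s v : wt (u :: s) v <= wt s v.
Proof.
apply: ler_wiXn2l; rewrite ?invr_ge0 ?invf_le1 ?ler1n //.
exact/subset_leq_card/cov_cons.
Qed.

(** The line through [u] in direction [a] misses [s], so appending [u] makes [a] a newly covered
    direction at each of its points. *)
Lemma wt_cons_half u s a t : a \notin cov s u ->
  wt (u :: s) (u + dirvec a t) <= 2^-1 * wt s (u + dirvec a t).
Proof.
move=> a_new; rewrite -exprS; apply: ler_wiXn2l; rewrite ?invr_ge0 ?invf_le1 ?ler1n //.
apply/proper_card/properP; split; first exact: cov_cons.
exists a; last by rewrite cov_dirvec.
rewrite inE /=; apply/orP; left; apply/existsP; exists (- t).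
by rewrite dirvecN addrK.
Qed.

Lemma total_wt_cons_le u s : total_wt (u :: s) <= total_wt s.
Proof. by apply: ler_sum => v _; apply: wt_cons_le. Qed.

Lemma total_wt_cons_drop u s :
  total_wt (u :: s) <=
  total_wt s - (\sum_(a | a \notin cov s u) linesum a (wt s) u - q) / 2.
Proof.
rewrite lerBrDr addrC -lerBrDr /total_wt -sumrB.
pose D v := wt s v - wt (u :: s) v.
have D_ge0 v : 0 <= D v by rewrite subr_ge0 wt_cons_le.
(* Parameters of the points on uncovered lines through [u]. Leaving out [u] itself makes [h]
   injective and costs weight at most 1 on each of at most [q] lines, whence the [- q]. *)
pose A := [set p : F * F | (p.1 \notin cov s u) && (p.2 != 0)].
pose h (p : F * F) := u + dirvec p.1 p.2.
have inj_h : {in A &, injective h}.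
  move=> [a t] [b r]; rewrite !inE /= => /andP[_ t0] _.
  by rewrite /h /= => /addrI[<- /(mulfI t0) -> _].
apply: (@le_trans _ _ (\sum_(v in h @: A) D v)); last first.
  rewrite [leRHS](bigID [in h @: A]) /= ler_wpDr //.
  by apply: sumr_ge0 => v _; apply: D_ge0.
rewrite big_imset //=.
apply: (@le_trans _ _ (\sum_(p in A) 2^-1 * wt s (h p))); last first.
  apply: ler_sum => -[a t]; rewrite inE /= => /andP[a_new _].
  by rewrite lerBrDr -lerBrDl; apply: le_trans (wt_cons_half t a_new) _; lra.
rewrite -mulr_sumr mulrC ler_pM2l ?invr_gt0 // lerBlDl.
have -> : \sum_(p in A) wt s (h p) =
    \sum_(a | a \notin cov s u) \sum_(t | t != 0) wt s (u + dirvec a t).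
  by rewrite pair_big_dep /=; apply: eq_bigl => p; rewrite inE.
apply: (@le_trans _ _ (\sum_(a | a \notin cov s u)
    (1 + \sum_(t | t != 0) wt s (u + dirvec a t)))).
  apply: ler_sum => a _; rewrite /linesum (bigD1 0) //= lerD2r.
  by case/andP: (wt01 s (u + dirvec a 0)).
rewrite big_split /= lerD2r sumr_const ler_nat.
exact: max_card.
Qed.

Lemma wt_mul_card_cov s u : wt s u * #|cov s u|%:R <= 2^-1.
Proof.
rewrite /wt; move: #|_| => j.
rewrite exprVn mulrC ler_pdivrMr ?exprn_gt0 // mulrC ler_pdivlMr //.
rewrite -natrX -natrM ler_nat; elim: j => // -[//|j].
by rewrite [(2 ^ j.+2)%N]expnS; move: (2 ^ j.+1)%N => m; lia.
Qed.

(** Cauchy-Schwarz over the covered directions brings in a factor [#|cov s u|], which [wt s u]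
    absorbs because [j / 2 ^ j <= 1 / 2]. The squared line sums are then summed over all points. *)
Lemma sum_wt_covered_le s (bad : {pred P}) :
  (forall u, u \in bad -> total_wt s <= 4 * q * \sum_(a in cov s u) linesum a (wt s) u) ->
  (\sum_(u in bad) wt s u) * total_wt s ^+ 2 <=
    8 * q ^+ 2 * (2 * q ^+ 2 * total_wt s + total_wt s ^+ 2).
Proof.
move=> badP; have q0 := q_gt0.
have W_ge0 : 0 <= total_wt s by apply: sumr_ge0 => v _; rewrite ltW ?wt_gt0.
apply: (@le_trans _ _ (8 * q ^+ 2 * \sum_v \sum_a linesum a (wt s) v ^+ 2)).
  2: by rewrite ler_pM2l ?mulr_gt0 ?exprn_gt0 //; exact: (sum_linesum_weight_le (wt01 s)).
rewrite mulr_suml mulr_sumr [leRHS](bigID [in bad]) /= ler_wpDr //.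
  apply: sumr_ge0 => v _; apply: mulr_ge0; first by rewrite mulr_ge0 ?exprn_ge0.
  by apply: sumr_ge0 => a _; apply: sqr_ge0.
apply: ler_sum => u /badP.
set Z := \sum_(a in _) _; set T := \sum_a _ => WZ.
have ZT : Z ^+ 2 <= #|cov s u|%:R * T.
  apply: le_trans (sqr_sum_le _ _) _; rewrite ler_wpM2l // /T.
  by rewrite [leRHS](bigID [in cov s u]) /= ler_wpDr // sumr_ge0 // => a _; apply: sqr_ge0.
have T_ge0 : 0 <= T by apply: sumr_ge0 => a _; apply: sqr_ge0.
have w0 := ltW (wt_gt0 s u).
have H1 : total_wt s ^+ 2 <= (4 * q) ^+ 2 * Z ^+ 2.
  rewrite -exprMn ler_sqr ?nnegrE //; exact: le_trans WZ.
apply: le_trans (ler_wpM2l w0 H1) _.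
apply: le_trans (ler_wpM2l w0 (ler_wpM2l (sqr_ge0 (4 * q)) ZT)) _.
have -> : wt s u * ((4 * q) ^+ 2 * (#|cov s u|%:R * T)) =
  (wt s u * #|cov s u|%:R) * (16 * q ^+ 2 * T) by ring.
apply: le_trans (ler_wpM2r _ (wt_mul_card_cov s u)) _.
  by rewrite !mulr_ge0 // exprn_ge0 // ltW.
by lra.
Qed.

(** A repeated point imposes no new condition, hence the factor 1. *)
Definition step_weight s u : R := if u \in s then 1 else wt s u.

(** * The potential and the weighted count of sequences *)

Section Potential.
Variable D : nat.
Hypothesis D_gt0 : (0 < D)%N.
Hypothesis D_big : (1 - (16 * q)^-1) ^+ D * q <= 1.

(* When [W >= 8 q ^ 2], shrinking [W] by the factor [1 - 1 / (16 q)] either lowers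
   the potential by the factor [1 / q], which makes up for a total weight
   [W <= q ^ 3], or brings it down to [1]. *)
Definition potential (W : R) : R := Num.max 1 (W / (8 * q ^+ 2)) ^+ D.

Lemma potential_ge1 W : 1 <= potential W.
Proof. by rewrite exprn_ege1 // le_max lexx. Qed.

Lemma potential_le W W' : W <= W' -> potential W <= potential W'.
Proof.
have max_ge0 (V : R) : 0 <= Num.max 1 V by rewrite le_max ler01.
move=> WW'; apply: lerXn2r; rewrite ?nnegrE //.
rewrite ge_max !le_max lexx /=; apply/orP; right.
by rewrite ler_wpM2r // invr_ge0 mulr_ge0 // exprn_ge0.
Qed.

Lemma potential_shrink W : 8 * q ^+ 2 <= W -> W <= q ^+ 3 ->
  W * potential (W - W / (16 * q)) <= 8 * q ^+ 2 * potential W.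
Proof.
move=> W_ge W_le; have q0 := q_gt0.
have c_gt0 : 0 < 8 * q ^+ 2 by rewrite mulr_gt0 // exprn_gt0.
pose Y := W / (8 * q ^+ 2).
have WY : W = 8 * q ^+ 2 * Y by rewrite /Y mulrC divfK // gt_eqF.
have Y_ge1 : 1 <= Y by rewrite /Y ler_pdivlMr // mul1r.
have Y_gt0 : 0 < Y by apply: lt_le_trans Y_ge1.
have Y_le : Y <= q.
  rewrite /Y ler_pdivrMr // (le_trans W_le) // mulrCA -exprS.
  by rewrite ler_peMl ?exprn_ge0 ?ler1n // ltW.
rewrite /potential -/Y (max_r Y_ge1).
have -> : (W - W / (16 * q)) / (8 * q ^+ 2) = Y * (1 - (16 * q)^-1).
  by rewrite /Y; field; rewrite gt_eqF.
rewrite {1}WY -[leLHS]mulrA ler_pM2l //.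
(* Above the threshold, [D_big] gains a factor [1 / q <= 1 / Y]; below it the new potential is 1,
   and [Y <= Y ^ D] suffices. *)
case: (leP 1 (Y * (1 - (16 * q)^-1))) => _.
  rewrite exprMn mulrCA ler_piMr ?exprn_ge0 ?(ltW Y_gt0) //.
  apply: le_trans D_big; rewrite mulrC ler_wpM2l // exprn_ge0 //.
  rewrite subr_ge0 invf_le1 ?mulr_gt0 //.
  have : 1 <= q by rewrite ler1n; apply/card_gt0P; exists 0.
  lra.
by rewrite expr1n mulr1; apply: ler_eXnr.
Qed.

Lemma step_weight_sum s : (size s <= #|F| ^ 2)%N ->
  \sum_u step_weight s u * potential (total_wt (u :: s)) <=
    21 * q ^+ 2 * potential (total_wt s).
Proof.
move=> size_s; have q0 := q_gt0; have q_ge0 := ltW q_gt0.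
set W := total_wt s.
have W_le : W <= q ^+ 3.
  rewrite -card_point -[leRHS]mulr1 -sumr_card.
  by apply: ler_sum => v _; case/andP: (wt01 s v).
have G_ge0 V : 0 <= potential V by apply: le_trans (potential_ge1 V).
have sum_ind (A : {pred P}) : \sum_u (u \in A)%:R = #|A|%:R :> R.
  by rewrite -sum1_card natr_sum [RHS]big_mkcond; apply: eq_bigr => u; case: (_ \in _).
have cards : \sum_u (u \in s)%:R <= q ^+ 2 :> R.
  by rewrite sum_ind -natrX ler_nat (leq_trans (card_size s)).
have fac u : step_weight s u <= (u \in s)%:R + wt s u.
  rewrite /step_weight; case: ifP => _; first by rewrite lerDl ltW ?wt_gt0.
  by rewrite add0r.
have fac_ge0 u : 0 <= step_weight s u.
  by rewrite /step_weight; case: ifP => // _; rewrite ltW ?wt_gt0.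
have pot_cons u : potential (total_wt (u :: s)) <= potential W.
  exact/potential_le/total_wt_cons_le.
have [W_lt|W_ge] := ltP W (8 * q ^+ 2).
  apply: (@le_trans _ _ (\sum_u ((u \in s)%:R + wt s u) * potential W)).
    by apply: ler_sum => u _; apply: ler_pM.
  rewrite -mulr_suml ler_wpM2r // big_split /=.
  apply: le_trans (lerD cards (ltW W_lt)) _.
  by have := exprn_ge0 2 q_ge0; lra.
have W_gt0 : 0 < W by apply: lt_le_trans W_ge; rewrite mulr_gt0 ?exprn_gt0.
(* Outside [bad1] and [bad2], the uncovered lines through [u] carry weight at
   least [W / (4 q)], and half of it is lost when [u] is appended. *)
pose bad1 := [pred u | allsum (wt s) u < W / (2 * q)].
pose bad2 := [pred u | W <= 4 * q * \sum_(a in cov s u) linesum a (wt s) u].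
have bad1_le : #|bad1|%:R <= 2 * q ^+ 2.
  have H := card_allsum_small_le (wt01 s).
  rewrite -(ler_pM2r W_gt0); apply: le_trans H _.
  have := ler_wpM2l (exprn_ge0 2 q_ge0) W_ge; rewrite -[_ ^+ 4]/(_ ^+ (2 + 2)) exprD.
  by lra.
have bad2_le : \sum_(u in bad2) wt s u <= 10 * q ^+ 2.
  have := @sum_wt_covered_le s bad2 (fun u => id); rewrite -/W => H.
  rewrite -(ler_pM2r (exprn_gt0 2 W_gt0)); apply: le_trans H _.
  have := ler_wpM2l (exprn_ge0 2 q_ge0) (ler_wpM2r (ltW W_gt0) W_ge).
  by rewrite -expr2; lra.
have good u : u \notin bad1 -> u \notin bad2 -> total_wt (u :: s) <= W - W / (16 * q).
  rewrite !inE -leNgt -ltNge => good1 good2.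
  apply: le_trans (total_wt_cons_drop u s) _; rewrite -/W lerD2l lerN2.
  have {good2} : \sum_(a in cov s u) linesum a (wt s) u < W / (4 * q).
    by rewrite ltr_pdivlMr ?mulr_gt0 // mulrC.
  move: good1; rewrite /allsum (bigID [in cov s u]) /=.
  (* The correction [q] eats at most half of the uncovered weight [W / (4 q)]; halving what is left
     gives the loss [W / (16 q)]. *)
  have : q <= W / (8 * q).
    by rewrite ler_pdivlMr ?mulr_gt0 // mulrCA -expr2.
  have e (k : R) : W / (k * q) = W / q / k by rewrite invfM mulrA mulrAC.
  rewrite !e; lra.
apply: (@le_trans _ _ (\sum_u (((u \in s)%:R + (u \in bad1)%:R
    + (if u \in bad2 then wt s u else 0)) * potential W
    + wt s u * potential (W - W / (16 * q))))).
  apply: ler_sum => u _; have wt0 := ltW (wt_gt0 s u).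
  have wtG_ge0 V : 0 <= wt s u * potential V by rewrite mulr_ge0.
  have [u_s|u_s] := boolP (u \in s).
    rewrite /step_weight u_s mul1r mulr1n !mulrDl mul1r -!addrA; apply: ler_wpDr => //.
    by rewrite !addr_ge0 ?mulr_ge0 //; case: ifP.
  rewrite /step_weight (negPf u_s) add0r.
  have [u1|u1] := boolP (u \in bad1).
    rewrite mulr1n !mulrDl mul1r -!addrA; apply: ler_wpDr.
      by rewrite addr_ge0 ?mulr_ge0 //; case: ifP.
    apply: le_trans (pot_cons u); rewrite ler_piMl //.
    by case/andP: (wt01 s u).
  have [u2|u2] := boolP (u \in bad2).
    by rewrite add0r; apply: ler_wpDr => //; rewrite ler_wpM2l.
  by rewrite addr0 mul0r add0r ler_wpM2l // potential_le // good.
rewrite big_split -!mulr_suml /= !big_split /= -big_mkcond /= !sum_ind.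
apply: (@le_trans _ _ ((q ^+ 2 + 2 * q ^+ 2 + 10 * q ^+ 2) * potential W
   + 8 * q ^+ 2 * potential W)).
  rewrite lerD ?potential_shrink // ler_wpM2r // !lerD //.
  by rewrite -sum_ind.
by rewrite -mulrDl ler_wpM2r //; have := exprn_ge0 2 q_ge0; lra.
Qed.

(** For empty [s], an upper bound on the average number, over all labelings, of independent
    [k]-tuples of points. *)
Fixpoint weighted_count k s : R :=
  if k is k'.+1 then \sum_u step_weight s u * weighted_count k' (u :: s) else 1.

Lemma weighted_count_le k s : (size s + k <= #|F| ^ 2)%N ->
  weighted_count k s <= (21 * q ^+ 2) ^+ k * potential (total_wt s).
Proof.
elim: k s => [|k IHk] s sk /=; first by rewrite expr0 mul1r potential_ge1.
have c_ge0 : 0 <= 21 * q ^+ 2 by rewrite mulr_ge0 ?exprn_ge0.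
apply: (@le_trans _ _ (\sum_u (21 * q ^+ 2) ^+ k *
    (step_weight s u * potential (total_wt (u :: s))))).
  apply: ler_sum => u _; rewrite mulrCA ler_wpM2l //.
    by rewrite /step_weight; case: ifP => // _; rewrite ltW ?wt_gt0.
  by rewrite IHk //= addSnnS.
rewrite -mulr_sumr [_ ^+ k.+1]exprSr -mulrA ler_wpM2l ?exprn_ge0 // step_weight_sum //.
by rewrite (leq_trans _ sk) ?leq_addr.
Qed.

End Potential.
End Weights.

(** * Random splittings of the lines and random maps *)

Section LineGraph.
Variables (R : realFieldType) (F : finFieldType).
Local Notation P := (F * F * F)%type.
Local Notation labeling := {ffun F * P -> bool}.
Local Notation q := (#|F|%:R : R).
Implicit Types (a b c t : F) (u v x y z : P) (s : seq P) (h : labeling).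

(* On every line, [h] splits the points into two classes, which are joined
   completely. *)
Definition line_adj h x y :=
  [exists a, exists t, (y == x + dirvec a t) && (h (a, x) != h (a, y))].

Lemma line_adjP h x y :
  reflect (exists a t, y = x + dirvec a t /\ h (a, x) != h (a, y)) (line_adj h x y).
Proof.
apply: (iffP existsP) => [[a /existsP[t /andP[/eqP yx hxy]]]|[a [t [yx hxy]]]].
  by exists a, t.
by exists a; apply/existsP; exists t; rewrite -yx eqxx.
Qed.

Lemma line_adj_sym h x y : line_adj h x y = line_adj h y x.
Proof.
suff H x' y' : line_adj h x' y' -> line_adj h y' x' by apply/idP/idP; apply: H.
case/line_adjP => a [t [yx hxy]]; apply/line_adjP; exists a, (- t).
by rewrite yx dirvecN addrK -yx eq_sym.
Qed.

Lemma line_adj_irrefl h x : line_adj h x x = false.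
Proof. by apply/line_adjP => -[a [t [_]]]; rewrite eqxx. Qed.

(** Three distinct directions contradict [dirvec_indep]. Two equal directions force the third to
    agree, and then three points of one line would need three different classes. *)
Lemma line_adj_trianglefree h x y z :
  line_adj h x y -> line_adj h y z -> line_adj h z x -> False.
Proof.
have neq0 u a t : h (a, u) != h (a, u + dirvec a t) -> t != 0.
  by apply: contraNneq => ->; rewrite dirvec0 addr0.
case/line_adjP => a [r [-> ha]] /line_adjP[b [s [-> hb]]] /line_adjP[c [t [ex hc]]].
have r0 := neq0 _ _ _ ha; have s0 := neq0 _ _ _ hb.
have t0 : t != 0 by apply: (neq0 (x + dirvec a r + dirvec b s) c); rewrite -ex.
have e : dirvec a r + dirvec b s + dirvec c t = 0.
  by apply: (addrI x); rewrite addr0 !addrA -ex.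
have par (a' b' r' s' : F) : a' != b' -> dirvec a' r' + dirvec b' s' = 0 -> r' = 0.
  move=> ab [e0 e1 _]; have: r' * (a' - b') = 0.
    transitivity ((r' * a' + s' * b') - (r' + s') * b'); first by ring.
    by rewrite e0 e1 mul0r subrr.
  by move/eqP; rewrite mulf_eq0 subr_eq0 (negPf ab) orbF => /eqP.
have [ab|ab] := eqVneq a b.
  subst b; have [ac|ac] := eqVneq a c.
    by subst c; move: ha hb hc; case: (h _) (h _) (h _) => -[] [].
  move: e; rewrite -dirvecD addrC => /(par _ _ _ _ _) e; move: t0.
  by rewrite e ?eqxx // eq_sym.
have [ac|ac] := eqVneq a c.
  subst c; move: e; rewrite addrAC -dirvecD addrC => /(par _ _ _ _ _) e; move: s0.
  by rewrite e ?eqxx // eq_sym.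
have [bc|bc] := eqVneq b c.
  subst c; move: e; rewrite -addrA -dirvecD => /(par _ _ _ _ _) e; move: r0.
  by rewrite e ?eqxx.
by case: (dirvec_indep ab ac bc e) => r00; rewrite r00 eqxx in r0.
Qed.

Definition indep h s := all (fun x => all (fun y => ~~ line_adj h x y) s) s.

Lemma indepP h s : reflect {in s &, forall x y, ~~ line_adj h x y} (indep h s).
Proof.
apply: (iffP allP) => [H x y xs ys|H x xs]; first by move/allP: (H x xs); apply.
by apply/allP => y ys; apply: H.
Qed.

Definition indep_count s : nat := #|[set h | indep h s]|.

(* Flip the labels that [h] puts at [u] in directions covered by [s]. Since [h]
   is determined there by its values on [s], the map is injective. *)
Lemma indep_count_cons u s : u \notin s ->
  (indep_count (u :: s) * 2 ^ #|cov s u| <= indep_count s)%N.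
Proof.
move=> us; rewrite -card_powerset -cardsX.
pose fl (p : labeling * {set F}) : labeling :=
  [ffun ax => p.1 ax (+) ((ax.2 == u) && (ax.1 \in p.2))].
have fl_s p a x : x \in s -> fl p (a, x) = p.1 (a, x).
  move=> xs; rewrite ffunE /=; case: eqP => [xu|_]; last by rewrite addbF.
  by rewrite -xu xs in us.
rewrite -(card_in_imset (f := fl)); last first.
  move=> [h1 e1] [h2 e2]; rewrite !inE /= => /andP[/indepP i1 c1] /andP[/indepP i2 c2] e12.
  have hs a x : x \in s -> h1 (a, x) = h2 (a, x).
    by move=> xs; rewrite -(fl_s (h1, e1)) // e12 fl_s.
  have hu a : a \in cov s u -> h1 (a, u) = h2 (a, u).
    rewrite inE => /hasP[x xs /existsP[t /eqP xu]].
    have eq_hx h : {in u :: s &, forall x y, ~~ line_adj h x y} -> h (a, u) = h (a, x).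
      move=> ih; apply/eqP; apply: contraNT (ih u x _ _); rewrite ?inE ?eqxx ?xs ?orbT //.
      by move=> hux; apply/line_adjP; exists a, t.
    by rewrite (eq_hx _ i1) (eq_hx _ i2) hs.
  have he a : h1 (a, u) = h2 (a, u) /\ (a \in e1) = (a \in e2).
    have := congr1 (fun g : labeling => g (a, u)) e12; rewrite !ffunE /= eqxx /=.
    have [ac|ac] := boolP (a \in cov s u); first by rewrite hu // => /addbI.
    have -> : (a \in e1) = false by apply: contraNF ac => /(subsetP c1).
    have -> : (a \in e2) = false by apply: contraNF ac => /(subsetP c2).
    by rewrite !addbF.
  congr pair; last by apply/setP => a; case: (he a).
  apply/ffunP => -[a x]; have := congr1 (fun g : labeling => g (a, x)) e12.
  rewrite !ffunE /=; case: eqP => [->|_] /=; last by rewrite !addbF.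
  by case: (he a).
apply: subset_leq_card; apply/subsetP => h' /imsetP[[h e]]; rewrite !inE /=.
case/andP => /indepP ih _ ->; apply/indepP => x y xs ys.
have : ~~ line_adj h x y by apply: ih; rewrite inE ?xs ?ys orbT.
apply: contra => /line_adjP[a [t [yx]]]; rewrite !fl_s //= => hxy.
by apply/line_adjP; exists a, t.
Qed.

Lemma indep_count_step u s :
  (indep_count (u :: s))%:R <= step_weight R s u * (indep_count s)%:R.
Proof.
rewrite /step_weight; case: ifPn => us.
  rewrite mul1r ler_nat; apply: subset_leq_card; apply/subsetP => h; rewrite !inE.
  by move=> /indepP ih; apply/indepP => x y xs ys; apply: ih; rewrite inE ?xs ?ys orbT.
rewrite mulrC /wt exprVn ler_pdivlMr ?exprn_gt0 // -natrX -natrM ler_nat.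
exact: indep_count_cons.
Qed.

Lemma weighted_count_ge0 k s : 0 <= weighted_count R k s.
Proof.
elim: k s => [|k IHk] s //=; apply: sumr_ge0 => u _.
by rewrite mulr_ge0 // /step_weight; case: ifP => // _; rewrite ltW ?wt_gt0.
Qed.

Section Maps.
Variable V : finType.

(** For a random map, the value at [v] is uniform and independent of the other values: the
    involution [swap] exchanges it with a fresh point. *)
Lemma sum_ffun_update (g : {ffun V -> P} -> P -> R) (v : V) :
  (forall (phi phi' : {ffun V -> P}) p, (forall w, w != v -> phi w = phi' w) -> g phi p = g phi' p) ->
  q ^+ 3 * \sum_(phi : {ffun V -> P}) g phi (phi v) = \sum_p \sum_phi g phi p.
Proof.
move=> gv; rewrite exchange_big /= pair_bigA /=.
pose upd (phi : {ffun V -> P}) p : {ffun V -> P} :=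
  [ffun w => if w == v then p else phi w].
pose swap (fp : {ffun V -> P} * P) := (upd fp.1 fp.2, fp.1 v).
have swapK : involutive swap.
  move=> [phi p]; rewrite /swap /upd /=; congr pair; last by rewrite ffunE eqxx.
  by apply/ffunP => w; rewrite !ffunE; case: eqP => [->|].
rewrite [RHS](reindex_inj (inv_inj swapK)) /=.
rewrite -(pair_bigA _ (fun phi p => g (upd phi p) (phi v))) /= mulr_sumr.
apply: eq_bigr => phi _; rewrite -card_point -sumr_card; apply: eq_bigr => p _.
by apply: gv => w /negPf wv; rewrite ffunE wv.
Qed.

(** The vertices are mapped one at a time, each image costing a factor [step_weight]; [catrev]
    prepends the images in the order used by [weighted_count]. *)
Lemma sum_indep_count_le (vs : seq V) s : uniq vs ->
  q ^+ 3 ^+ size vs * \sum_(phi : {ffun V -> P}) (indep_count (catrev (map phi vs) s))%:R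
    <= #|{ffun V -> P}|%:R * (indep_count s)%:R * weighted_count R (size vs) s.
Proof.
elim: vs s => [|v vs IHvs] s; first by rewrite /= expr0 mul1r mulr1 sumr_card.
move=> /= /andP[v_vs uniq_vs]; rewrite exprSr -mulrA.
rewrite (sum_ffun_update (g := fun phi p =>
  (indep_count (catrev (map phi vs) (p :: s)))%:R)); last first.
  move=> phi phi' p e; congr (indep_count (catrev _ _))%:R; apply/eq_in_map => w ws.
  by apply: e; apply: contraTneq ws => ->.
rewrite !mulr_sumr; apply: ler_sum => p _; apply: le_trans (IHvs _ uniq_vs) _.
rewrite -!mulrA ler_wpM2l // mulrA ler_wpM2r //; last first.
  by rewrite mulrC indep_count_step.
exact: weighted_count_ge0.
Qed.

End Maps.

(** A union bound over [t]-cliques: every pair of a map and a labeling colors [G] without red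
    triangle, hence sends some [t]-clique to an independent sequence, and for a fixed clique this
    has probability at most [weighted_count R t [::] / q ^ (3 t)]. *)
Lemma ramsey_weighted_count_le (G : sgraph) (t : nat) : ramsey 3 t G ->
  q ^+ 3 ^+ t <= #|cliques t [set: G]|%:R * weighted_count R t ([::] : seq P).
Proof.
move=> ramG; pose Phi := {ffun G -> P}.
pose bad (T : {set G}) := [set p : Phi * labeling | indep p.2 (map p.1 (enum T))].
have bad_le (T : {set G}) : #|T| = t -> q ^+ 3 ^+ t * #|bad T|%:R <=
    #|Phi|%:R * #|labeling|%:R * weighted_count R t ([::] : seq P).
  move=> cT; have := sum_indep_count_le [::] (enum_uniq T).
  rewrite -cardE cT => H; apply: le_trans (le_trans H _); last first.
    rewrite ler_wpM2r ?weighted_count_ge0 //.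
    by rewrite ler_wpM2l // ler_nat max_card.
  rewrite ler_wpM2l ?exprn_ge0 // -natr_sum ler_nat.
  rewrite -sum1_card.
  rewrite (eq_bigl (fun p : Phi * labeling => true && indep p.2 (map p.1 (enum T)))); last first.
    by move=> p; rewrite inE.
  rewrite -(pair_big_dep xpredT
    (fun (phi : Phi) (h : labeling) => indep h (map phi (enum T))) (fun _ _ => 1%N)) /=.
  apply: leq_sum => phi _; rewrite sum1dep_card /indep_count; apply: subset_leq_card.
  apply/subsetP => h; rewrite !inE => /indepP ih; apply/indepP => x y.
  by rewrite !catrevE !cats0 !mem_rev; apply: ih.
have cover : setT \subset \bigcup_(T in cliques t [set: G]) bad T.
  apply/subsetP => -[phi h] _.
  pose chi (e : {set G}) := [exists x in e, exists y in e, line_adj h (phi x) (phi y)].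
  have chiE (x y : G) : chi [set x; y] = line_adj h (phi x) (phi y).
    apply/exists_inP/idP => [[x' x'e /exists_inP[y' y'e]]|hxy].
      move: x'e y'e; rewrite !inE => /orP[]/eqP-> /orP[]/eqP->;
        by rewrite ?line_adj_irrefl // line_adj_sym.
    by exists x; rewrite ?inE ?eqxx //; apply/exists_inP; exists y; rewrite ?inE ?eqxx ?orbT.
  case: (ramG chi) => /has_mono_cliqueP[T TC Tchi]; last first.
    apply/bigcupP; exists T => //; rewrite inE /=.
    apply/indepP => _ _ /mapP[x xT ->] /mapP[y yT ->].
    rewrite !mem_enum in xT yT.
    have [->|xy] := eqVneq x y; first by rewrite line_adj_irrefl.
    by rewrite -chiE Tchi.
  move: TC; rewrite inE => /and3P[_ /eqP cT _].
  move: (enum_uniq T) (mem_enum T) cT; rewrite cardE.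
  case: (enum T) => [|x [|y [|z []]]] //= + memT _.
  rewrite !inE negb_or !andbT => /andP[/andP[xy xz] yz]; exfalso.
  have [Tx Ty Tz] : [/\ x \in T, y \in T & z \in T].
    by rewrite -!memT !inE !eqxx !orbT.
  apply: (@line_adj_trianglefree h (phi x) (phi y) (phi z)); rewrite -chiE Tchi //.
  by rewrite eq_sym.
have all_le : (#|Phi| * #|labeling| <= \sum_(T in cliques t [set: G]) #|bad T|)%N.
  rewrite -card_prod -cardsT; apply: leq_trans (subset_leq_card cover) _.
  elim/big_rec2: _ => [|T k B _ le_k]; first by rewrite cards0.
  by rewrite (leq_trans (leq_card_setU _ _)) // leq_add2l.
have N_gt0 : 0 < #|Phi|%:R * #|labeling|%:R :> R.
  rewrite -natrM ltr0n muln_gt0; apply/andP; split.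
    by apply/card_gt0P; exists [ffun=> 0].
  by apply/card_gt0P; exists [ffun=> true].
rewrite -(ler_pM2r N_gt0).
apply: (@le_trans _ _ (q ^+ 3 ^+ t * \sum_(T in cliques t [set: G]) #|bad T|%:R)).
  by rewrite ler_wpM2l ?exprn_ge0 // -natrM -natr_sum ler_nat.
rewrite mulr_sumr -mulrA -sumr_card; apply: ler_sum => T.
by rewrite inE => /and3P[_ /eqP cT _]; rewrite [leRHS]mulrC bad_le.
Qed.

End LineGraph.

(** * Choice of [q] and the lower bound on the number of cliques *)

(** For [x = 1 / m], Bernoulli gives [2 <= (1 + x) ^ m], while the product of [1 + x] and [1 - x] is
    at most 1. *)
Lemma shrink_half (R : realFieldType) (m : nat) : (0 < m)%N ->
  2 * (1 - (m%:R)^-1) ^+ m <= 1 :> R.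
Proof.
move=> m_gt0; set x : R := m%:R^-1.
have m_gt0' : 0 < m%:R :> R by rewrite ltr0n.
have x_gt0 : 0 < x by rewrite invr_gt0.
have x_le1 : x <= 1 by rewrite invf_le1 // ler1n.
have bern k : 1 + k%:R * x <= (1 + x) ^+ k.
  elim: k => [|k IHk]; first by rewrite mul0r addr0 expr0.
  have x1 : 0 <= 1 + x by lra.
  rewrite exprS; apply: le_trans (ler_wpM2l x1 IHk); rewrite -natr1.
  have : 0 <= x * (k%:R * x) by rewrite !mulr_ge0 // ltW.
  by lra.
have {bern} := bern m; rewrite mulfV ?gt_eqF // => bern.
apply: (@le_trans _ _ ((1 + x) ^+ m * (1 - x) ^+ m)).
  by rewrite ler_wpM2r // exprn_ge0 // subr_ge0.
rewrite -exprMn exprn_ile1 //.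
  by rewrite mulr_ge0 //; lra.
have := mulr_ge0 (ltW x_gt0) (ltW x_gt0); lra.
Qed.

(** Take [q = 2 ^ k] and [D = 16 q k], so that [shrink_half] gives [D_big]. The initial potential is
    at most [q ^ D = 2 ^ (k * D) <= 2 ^ t], which turns 21 into 42, and [t <= 4 ^ k = q ^ 2] bounds
    the length of the sequences. *)
Lemma ramsey_card_cliques (G : sgraph) (t k : nat) :
  (0 < k)%N -> (16 * 2 ^ k * k ^ 2 <= t)%N -> (t <= 4 ^ k)%N -> ramsey 3 t G ->
  (2 ^ (k * t) <= #|cliques t [set: G]| * 42 ^ t)%N.
Proof.
move=> k_gt0 t_ge t_le ramG.
have [R _] : exists R : realFieldType, True by exists rat.
have [F _ cF] := @pPrimePowerField 2 k isT k_gt0.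
pose D := (16 * 2 ^ k * k)%N.
have D_gt0 : (0 < D)%N by rewrite !muln_gt0 expn_gt0 k_gt0.
have q_gt0 : 0 < #|F|%:R :> R by rewrite cF ltr0n expn_gt0.
have D_big : (1 - (16 * #|F|%:R)^-1) ^+ D * #|F|%:R <= 1 :> R.
  rewrite /D exprM -natrM cF natrX -exprMn exprn_ile1 //.
    rewrite mulr_ge0 ?exprn_ge0 // subr_ge0 invf_le1 ?ler1n ?ltr0n ?muln_gt0 ?expn_gt0 //.
  by rewrite mulrC shrink_half // muln_gt0 expn_gt0.
have q_ge1 : 1 <= #|F|%:R :> R by rewrite ler1n cF expn_gt0.
have W_le : total_wt R ([::] : seq (F * F * F)) <= #|F|%:R ^+ 3.
  rewrite -card_point -[leRHS]mulr1 -sumr_card.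
  by apply: ler_sum => v _; case/andP: (wt01 R [::] v).
have pot_le : potential F D (total_wt R ([::] : seq (F * F * F))) <= 2 ^+ t.
  apply: le_trans (potential_le F D W_le) _.
  apply: (@le_trans _ _ (#|F|%:R ^+ D)).
    apply: lerXn2r; rewrite ?nnegrE ?(ltW q_gt0) ?le_max ?ler01 //.
    rewrite ge_max q_ge1 /= ler_pdivrMr ?mulr_gt0 ?exprn_gt0 // exprS [leRHS]mulrCA.
    by rewrite ler_peMl ?ler1n // mulr_ge0 ?exprn_ge0.
  by rewrite cF natrX -exprM ler_weXn2l ?ler1n // mulnC -mulnA.
have le1 := ramsey_weighted_count_le R F ramG.
have le2 := @weighted_count_le R F D D_gt0 D_big t [::].
rewrite add0n cF -expnM mulnC expnM in le2.
have {le2} := le2 t_le; rewrite -/(2 ^ k)%N -cF => le2.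
have q2_gt0 : 0 < (#|F|%:R ^+ 2) ^+ t :> R by rewrite !exprn_gt0.
rewrite expnM -cF -(ler_nat R) natrM !natrX -(ler_pM2r q2_gt0) -exprMn -exprS.
apply: le_trans le1 _; rewrite -mulrA ler_wpM2l //.
apply: le_trans le2 _.
have -> : 42%:R ^+ t * (#|F|%:R ^+ 2) ^+ t = (21 * #|F|%:R ^+ 2) ^+ t * 2 ^+ t :> R.
  by rewrite -!exprMn; congr (_ ^+ t); ring.
by rewrite ler_wpM2l // exprn_ge0 // mulr_ge0 // exprn_ge0.
Qed.

(** Too few [s]-cliques would leave fewer than [N ^ t] ordered [t]-cliques. In [168 = 4 * 42], the 4
    comes from [expnn_le_fact] and the 42 from [ramsey_card_cliques]. *)
Lemma ramsey_ordered_cliques (G : sgraph) (s t k N : nat) :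
  (0 < k)%N -> (16 * 2 ^ k * k ^ 2 <= t)%N -> (t <= 4 ^ k)%N ->
  (168 * N <= t * 2 ^ k)%N -> (0 < s <= t)%N -> ramsey 3 t G ->
  (N ^ s <= ordered_cliques s [set: G])%N.
Proof.
move=> k_gt0 t_ge t_le N_le /andP[s_gt0 st] ramG.
have t_gt0 : (0 < t)%N by apply: leq_trans st.
rewrite leqNgt; apply/negP => s_lt.
have : (ordered_cliques t [set: G] < N ^ t)%N.
  rewrite -(ltn_exp2r _ _ s_gt0); apply: leq_ltn_trans (ordered_cliques_exp _ st) _.
  by rewrite -expnM mulnC expnM ltn_exp2r.
rewrite ltnNge => /negP; apply; rewrite -(@leq_pmul2l (168 ^ t)) ?expn_gt0 //.
rewrite -expnMn; apply: leq_trans (leq_expn2r t N_le) _.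
rewrite expnMn -expnM; apply: leq_trans (leq_mul (expnn_le_fact t)
  (ramsey_card_cliques k_gt0 t_ge t_le ramG)) _.
rewrite (_ : 168%N = 4 * 42)%N // expnMn /ordered_cliques.
by rewrite (mulnC #|_|) mulnACA.
Qed.

Lemma bin_le_cliques (G : sgraph) (s N : nat) :
  (N ^ s <= ordered_cliques s [set: G])%N -> ('C(N, s) <= #|copies (complete s) G|)%N.
Proof.
move=> le_N; rewrite card_copies -(leq_pmul2l (fact_gt0 s)) mulnC bin_ffact.
exact: leq_trans (leq_ffact_expn N s) le_N.
Qed.

(** The largest [k] with [16 * 2 ^ k * k ^ 2 <= t] works, its maximality giving the last bound. The
    start 13 is the first [k] with [32 * k.+1 ^ 2 <= 2 ^ k], which yields [t <= 4 ^ k]. *)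
Lemma exists_log_scale : exists t0, forall t, (t0 <= t)%N ->
  exists k, [/\ (0 < k)%N, (16 * 2 ^ k * k ^ 2 <= t)%N, (t <= 4 ^ k)%N &
    (t <= 32 * 2 ^ k * k.+1 ^ 2)%N].
Proof.
exists (16 * 2 ^ 13 * 13 ^ 2)%N => t t_big; pose p k := (16 * 2 ^ k * k ^ 2 <= t)%N.
have p13 : p 13%N by [].
have bnd k : p k -> (k <= t)%N.
  move=> pk; apply: leq_trans pk; case: k => // k.
  apply: leq_trans (leq_pmull _ _); first by rewrite -mulnn leq_pmulr.
  by rewrite muln_gt0 expn_gt0.
have [k pk max_k] := ex_maxnP (ex_intro p 13%N p13) bnd.
have k13 := max_k _ p13.
have t_lt : (t <= 32 * 2 ^ k * k.+1 ^ 2)%N.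
  have : ~~ p k.+1 by apply/negP => /max_k; rewrite ltnn.
  by rewrite /p -ltnNge expnS mulnA => /ltnW.
exists k; split=> //; first exact: leq_trans k13.
apply: leq_trans t_lt _.
rewrite (_ : 4%N = 2 ^ 2)%N // -expnM (mulnC 2) expnM -[leqRHS]mulnn mulnAC leq_mul2r.
apply/orP; right.
have -> : k = (k - 13 + 13)%N by rewrite subnK.
elim: (k - 13)%N => [|j IHj]; first by [].
rewrite addSn [leqRHS]expnS; apply: leq_trans (leq_mul (leqnn 2) IHj).
nia.
Qed.

(** * Asymptotics *)

Section Asymptotics.
Variable R : realType.

Definition clique_bound (c : R) (t : nat) : nat :=
  Num.truncn (c * t%:R ^+ 2 / ln (t%:R : R) ^+ 2).

Lemma ln2_ge : 2^-1 <= ln (2 : R).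
Proof.
rewrite -ler_expR lnK ?posrE //.
have := expR_ge1Dx (- 2^-1 : R); rewrite expRN => H.
have e_gt0 := expR_gt0 (2^-1 : R).
rewrite -(ler_pV2 (x := 2)) ?inE ?unitfE ?gt_eqF //=.
by apply: le_trans H; lra.
Qed.

Variables (c : R) (t0 : nat).
Hypotheses (c_gt0 : 0 < c) (c_le : 168 * 512 * c <= 1).
Hypothesis scale : forall t, (t0 <= t)%N ->
  exists k, [/\ (0 < k)%N, (16 * 2 ^ k * k ^ 2 <= t)%N, (t <= 4 ^ k)%N &
    (t <= 32 * 2 ^ k * k.+1 ^ 2)%N].

Let c_le4 : c <= 4.
Proof. by move: c_gt0 c_le => c0 c1; lra. Qed.

(** From [ln 2 >= 1 / 2] one gets [k + 1 <= 4 ln t], so [t <= 512 * 2 ^ k * ln t ^ 2] with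
    [512 = 32 * 4 ^ 2]; this and 168 dictate the condition on [c]. *)
Lemma bin_clique_bound_le (t s : nat) : (t0 <= t)%N -> (1 <= s <= t)%N ->
  ('C(clique_bound c t, s) <= F_ramsey_number (complete s) 3 t)%N.
Proof.
move=> t_big st; have [G ramG <-] := F_ramsey_numberP s t.
have [k [k_gt0 t_ge t_le t_lt]] := scale t_big.
have t_gt0 : (0 < t)%N by case/andP: st => s_gt0; apply: leq_trans.
apply: bin_le_cliques; apply: (ramsey_ordered_cliques k_gt0 t_ge t_le) => //.
have tR : 0 < t%:R :> R by rewrite ltr0n.
set L := ln (t%:R : R).
have k_le : k.+1%:R <= 4 * L.
  have : k%:R * ln (2 : R) <= L.
    rewrite mulrC mulr_natr -lnXn // ler_ln ?posrE ?exprn_gt0 // -natrX ler_nat.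
    apply: leq_trans t_ge; rewrite mulnAC leq_pmull // muln_gt0 expn_gt0.
    by rewrite k_gt0.
  have := ln2_ge; have : 1 <= k%:R :> R by rewrite ler1n.
  rewrite -[k.+1%:R]natr1 => k1 l2; have := ler_wpM2l (ler0n R k) l2; lra.
have L_gt0 : 0 < L.
  have : 0 < k.+1%:R :> R by rewrite ltr0n.
  by move: k_le; lra.
have L2_gt0 : 0 < L ^+ 2 by rewrite exprn_gt0.
rewrite -(ler_nat R) !natrM natrX.
have N_le : (clique_bound c t)%:R <= c * t%:R ^+ 2 / L ^+ 2.
  by rewrite truncn_le divr_ge0 ?(ltW L2_gt0) // mulr_ge0 ?exprn_ge0 ?(ltW c_gt0).
have t_le' : t%:R <= 512 * 2 ^+ k * L ^+ 2.
  move: t_lt; rewrite -(ler_nat R) !natrM !natrX => /le_trans; apply.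
  have -> : 512 * 2 ^+ k * L ^+ 2 = 32 * 2 ^+ k * (4 * L) ^+ 2 by ring.
  have L4 : 0 <= 4 * L by rewrite mulr_ge0 // ltW.
  by rewrite ler_pM2l ?mulr_gt0 ?exprn_gt0 // ler_sqr ?nnegrE.
apply: le_trans (ler_wpM2l (ler0n _ _) N_le) _.
have -> : 168 * (c * t%:R ^+ 2 / L ^+ 2) = t%:R * (168 * c * t%:R / L ^+ 2).
  by field; rewrite gt_eqF.
rewrite ler_pM2l // ler_pdivrMr //.
have c168 : 0 <= 168 * c := mulr_ge0 (ler0n _ _) (ltW c_gt0).
apply: le_trans (ler_wpM2l c168 t_le') _.
have := ler_wpM2r (ltW (mulr_gt0 (exprn_gt0 k (ltr0Sn R 1)) L2_gt0)) c_le.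
lra.
Qed.

(* [K] is chosen so that [ramsey_eps t < 1] already forces [t] to be large. *)
Let a : R := ln (4 / c).
Let K : R := 4 * (a + 4) + ln (t0.+1%:R) + 2.

(** The true loss is of order [log log t / log t]; this weaker rate needs only [ln x < x]. The
    summand 1 keeps the root positive at [t = 1]. *)
Definition ramsey_eps (t : nat) : R := K / Num.sqrt (1 + ln (t%:R : R)).

Lemma eps_cvg0 : (ramsey_eps t @[t --> \oo] --> (0 : R))%classic.
Proof.
apply/cvgrPdist_lt => e e_gt0; near=> t.
have t_big : expR ((`|K| / e) ^+ 2) < t%:R by near: t; exact: nbhs_infty_gtr.
have tR : 0 < t%:R :> R by apply: lt_trans t_big; apply: expR_gt0.
have L_big : (`|K| / e) ^+ 2 < ln (t%:R : R) by rewrite -ltr_expR lnK.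
have L1_gt0 : 0 < 1 + ln (t%:R : R).
  by rewrite addr_gt0 //; apply: le_lt_trans L_big; apply: sqr_ge0.
rewrite sub0r normrN /ramsey_eps normrM normfV (ger0_norm (sqrtr_ge0 _)).
rewrite ltr_pdivrMr ?sqrtr_gt0 // mulrC -ltr_pdivrMr //.
rewrite -(ger0_norm (divr_ge0 (normr_ge0 K) (ltW e_gt0))) -sqrtr_sqr ltr_sqrt //.
by apply: lt_trans L_big _; rewrite ltrDr.
Unshelve. all: by end_near.
Qed.

(** With [M = 'C(N, s)], one has [x ^ s <= M] and ['C(r(3, t), s) <= M * y ^ s], where
    [ln y <= eps * ln x]. So the left binomial is at most [M ^ (1 + eps)], and
    [1 - eps ^ 2 <= 1]. *)
Lemma bin_powR_eps_le (t s : nat) : (1 <= s <= t)%N ->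
  ('C(ramsey_number 3 t, s)%:R : R) `^ (1 - ramsey_eps t)
         <= (F_ramsey_number (complete s) 3 t)%:R.
Proof.
move=> st; have /andP[s_gt0 s_le] := st.
have t_gt0 : (0 < t)%N by apply: leq_trans s_le.
have F_gt0 : (0 < F_ramsey_number (complete s) 3 t)%N.
  by have [G ramG <-] := F_ramsey_numberP s t; apply: ramsey_cliques_gt0 ramG.
set C := 'C(ramsey_number 3 t, s).
have C_gt0 : (0 < C)%N by apply: leq_trans F_gt0 (F_ramsey_number_le_bin s t).
have C_ge1 : 1 <= C%:R :> R by rewrite ler1n.
have C_ge0 : 0 <= ln (C%:R : R) by apply: ln_ge0.
rewrite /powR gt_eqF ?ltr0n //.
(* For small [t] the exponent is nonpositive, and the right side is at least 1 by [F_gt0]. *)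
have [eps_ge1|eps_lt1] := lerP 1 (ramsey_eps t).
  apply: (@le_trans _ _ 1); last by rewrite ler1n.
  by rewrite expR_le1 mulr_le0_ge0 // subr_le0.
set L := ln (t%:R : R); pose sg := Num.sqrt L; pose rho := Num.sqrt (1 + L).
have L_ge0 : 0 <= L by rewrite ln_ge0 ?ler1n.
have a_ge0 : 0 <= a.
  by rewrite ln_ge0 // ler_pdivlMr // mul1r.
have lnt0_ge0 : 0 <= ln (t0.+1%:R : R).
  by rewrite ln_ge0 // ler1n.
have K_ge : 18 <= K by rewrite /K; lra.
have L1_gt0 : 0 < 1 + L by lra.
have rho_gt0 : 0 < rho by rewrite sqrtr_gt0.
have rho_gt : K < rho by move: eps_lt1; rewrite /ramsey_eps ltr_pdivrMr // mul1r.
have rho2 : rho ^+ 2 = 1 + L by rewrite sqr_sqrtr // ltW.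
have sg2 : sg ^+ 2 = L by rewrite sqr_sqrtr.
have sg_ge0 : 0 <= sg by apply: sqrtr_ge0.
have L_big : K + 1 <= L.
  have : K * K <= rho * rho by apply: ler_pM => //; lra.
  rewrite -!expr2 rho2; nra.
have rho_le : rho <= 2 * sg.
  rewrite -ler_sqr ?nnegrE ?mulr_ge0 ?(ltW rho_gt0) // exprMn rho2 sg2; lra.
have sg_ge1 : 1 <= sg by lra.
have tR : 0 < t%:R :> R by rewrite ltr0n.
have t_big : (t0 <= t)%N.
  apply: ltnW; rewrite -(ler_nat R) -ler_ln ?posrE // -/L.
  by move: L_big; rewrite /K; lra.
have L_gt0 : 0 < L by lra.
(* Thus [t x y = t ^ 2] bounds [r(3, t)], and [4 t x] is the real number rounded down to [N]. The
   factor 4 leaves room for the rounding and for [t x <= N - s]. *)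
pose y : R := 4 * L ^+ 2 / c; pose x : R := t%:R / y.
have y_gt0 : 0 < y by rewrite divr_gt0 ?mulr_gt0 ?exprn_gt0.
have x_gt0 : 0 < x by rewrite divr_gt0.
have lny : ln y <= (a + 4) * sg.
  have -> : y = 4 / c * (sg ^+ 4).
    by rewrite /y -sg2 -exprM mulrAC.
  rewrite lnM ?posrE ?divr_gt0 ?exprn_gt0 //; last by lra.
  rewrite lnXn; last by lra.
  have : ln sg < sg by apply: ln_sublinear; lra.
  have : a <= a * sg by rewrite ler_peMr.
  by rewrite -/a -mulr_natl; lra.
have half : (a + 4) * sg <= L / 2.
  rewrite -sg2 expr2; have : a + 4 <= sg / 2 by move: rho_gt; rewrite /K; lra.
  by move=> /(ler_wpM2r sg_ge0); lra.
have lnx : ln x = L - ln y by rewrite ln_div ?posrE.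
have lnx_ge : L / 2 <= ln x by rewrite lnx; lra.
have x_ge1 : 1 <= x by rewrite -ler_ln ?posrE // ln1; lra.
have lny_le : ln y <= ramsey_eps t * ln x.
  apply: (@le_trans _ _ (ramsey_eps t * (L / 2))); last first.
    by rewrite ler_wpM2l // /ramsey_eps divr_ge0 ?(ltW rho_gt0) //; lra.
  apply: le_trans lny _; rewrite /ramsey_eps -/L -/rho -sg2.
  have : (a + 4) * rho <= (a + 4) * (2 * sg) by rewrite ler_wpM2l //; lra.
  move=> H; rewrite mulrAC ler_pdivlMr //.
  have {H} := ler_wpM2l sg_ge0 H; have : 0 <= sg * sg by rewrite mulr_ge0.
  have : 4 * (a + 4) * (sg * sg) <= K * (sg * sg).
    by rewrite ler_wpM2r ?mulr_ge0 // /K; lra.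
  rewrite expr2; lra.
set N := clique_bound c t.
have N_ge : 2 * t%:R * x <= N%:R.
  have : 4 * t%:R * x < N.+1%:R.
    have -> : 4 * t%:R * x = c * t%:R ^+ 2 / L ^+ 2.
      by rewrite /x /y; field; rewrite !gt_eqF.
    exact: truncnS_gt.
  have : 1 <= t%:R * x.
    by rewrite mulr_ege1 ?ler1n.
  rewrite -[N.+1%:R]natr1; lra.
have sfact_gt0 : 0 < s`!%:R :> R by rewrite ltr0n fact_gt0.
have Ns_ge : (t%:R * x) ^+ s <= (N ^_ s)%:R.
  apply: (@le_trans _ _ ((N - s) ^ s)%:R); last by rewrite ler_nat leq_subn_ffact.
  have tx_ge0 : 0 <= t%:R * x by rewrite mulr_ge0 ?(ltW x_gt0).
  rewrite natrX; apply: lerXn2r; rewrite ?nnegrE //.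
  have tx_ge : s%:R <= t%:R * x.
    by apply: (@le_trans _ _ t%:R); rewrite ?ler_nat // ler_peMr.
  rewrite natrB; first by lra.
  by rewrite -(ler_nat R); lra.
have M_ge : x ^+ s <= 'C(N, s)%:R.
  rewrite -(ler_pM2r sfact_gt0) -natrM bin_ffact.
  apply: le_trans Ns_ge; rewrite [leRHS]exprMn [leLHS]mulrC ler_wpM2r ?exprn_ge0 ?(ltW x_gt0) //.
  rewrite -natrX ler_nat -ffactnn; apply: leq_trans (leq_ffact_expn s s) _.
  exact: leq_expn2r.
have C_le : C%:R <= 'C(N, s)%:R * y ^+ s.
  rewrite -(ler_pM2r sfact_gt0) -natrM bin_ffact mulrAC -natrM bin_ffact.
  apply: (@le_trans _ _ ((t%:R * x) ^+ s * y ^+ s)); last first.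
    by rewrite ler_wpM2r ?exprn_ge0 ?(ltW y_gt0).
  rewrite -exprMn.
  have -> : t%:R * x * y = (t ^ 2)%:R.
    by rewrite /x -mulrA divfK ?gt_eqF // natrX expr2.
  rewrite -natrX ler_nat; apply: leq_trans (leq_ffact_expn _ _) _.
  by apply: leq_expn2r; apply: ramsey_number_le.
have M_gt0 : 0 < 'C(N, s)%:R :> R by apply: lt_le_trans M_ge; rewrite exprn_gt0.
apply: (@le_trans _ _ ('C(N, s)%:R)); last by rewrite ler_nat bin_clique_bound_le.
rewrite -[leRHS]lnK ?posrE // ler_expR.
have lnM_ge : s%:R * ln x <= ln ('C(N, s)%:R : R).
  by rewrite mulr_natl -lnXn // ler_ln ?posrE ?exprn_gt0.
have lnC_le : ln (C%:R : R) <= ln ('C(N, s)%:R : R) + s%:R * ln y.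
  have C_gt0R : 0 < C%:R :> R by rewrite ltr0n.
  have ys_gt0 : 0 < y ^+ s by rewrite exprn_gt0.
  by rewrite mulr_natl -lnXn // -lnM ?posrE // ler_ln ?posrE // mulr_gt0.
have eps_ge0 : 0 <= ramsey_eps t by rewrite divr_ge0 ?(ltW rho_gt0) //; lra.
have h1 : s%:R * ln y <= ramsey_eps t * ln ('C(N, s)%:R : R).
  apply: le_trans (ler_wpM2l (ler0n R s) lny_le) _.
  by rewrite mulrCA ler_wpM2l.
have lnM_ge0 : 0 <= ln ('C(N, s)%:R : R).
  by apply: le_trans lnM_ge; rewrite mulr_ge0 //; lra.
have h2 : (1 - ramsey_eps t) * ln (C%:R : R) <=
    (1 - ramsey_eps t) * ((1 + ramsey_eps t) * ln ('C(N, s)%:R : R)).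
  by rewrite ler_wpM2l //; lra.
apply: le_trans h2 _; rewrite mulrA ler_piMl //.
by have := sqr_ge0 (ramsey_eps t); rewrite expr2; lra.
Qed.

End Asymptotics.

Unset Implicit Arguments.
Local Open Scope classical_set_scope.

Theorem theorem1p2 (R : realType) :
  (exists c : R, 0 < c /\ exists t0 : nat, forall t s : nat,
     (t0 <= t)%N -> (1 <= s <= t)%N ->
     ('C(Num.truncn (c * t%:R ^+ 2 / ln (t%:R : R) ^+ 2), s)
        <= F_ramsey_number (complete s) 3 t)%N)
  /\
  (exists eps : nat -> R, eps t @[t --> \oo] --> (0 : R) /\
     forall t s : nat, (1 <= s <= t)%N ->
       ('C(ramsey_number 3 t, s)%:R : R) `^ (1 - eps t)
         <= (F_ramsey_number (complete s) 3 t)%:R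
       /\ (F_ramsey_number (complete s) 3 t <= 'C(ramsey_number 3 t, s))%N).
Proof.
have [t0 scale] := exists_log_scale.
(* The largest value that [c_le] allows. *)
pose c : R := (168 * 512)^-1.
have d_gt0 : 0 < 168 * 512 :> R by rewrite mulr_gt0 ?ltr0n.
have c_gt0 : 0 < c by rewrite invr_gt0.
have c_le : 168 * 512 * c <= 1.
  by rewrite /c mulfV; [exact: lexx|exact: lt0r_neq0].
split.
  exists c; split=> //; exists t0 => t s t_ge st.
  exact: (bin_clique_bound_le c_gt0 c_le scale).
exists (ramsey_eps c t0); split; first exact: eps_cvg0.
move=> t s st; split; last exact: F_ramsey_number_le_bin.
exact: (bin_powR_eps_le c_gt0 c_le scale).
Qed.
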